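(* Let $\mathfrak{n}_{5,2}\oplus\mathbb{R}^2=(0,0,0,0,f^{12},f^{13},0)$ be endowed with the metric $$g=\sum_{i=1}^4f^i\odot f^i+E\,f^5\odot f^5+G\,f^6\odot f^6+f^7\odot f^7,$$ where $0<E\le G$. Then there exists a purely coclosed $\mathrm{G}_2$-structure $\varphi$ on $\mathfrak{n}_{5,2}\oplus\mathbb{R}^2$ with $g_\varphi=g$ if and only if $G=E$.
   Context: Lie algebras are real and described by the tuple $(\mathrm{d}f^1,\dots,\mathrm{d}f^7)$ for a basis $\{f^1,\dots,f^7\}$ of $\mathfrak{n}^*$, with $f^{ij}=f^i\wedge f^j$; $\mathrm{d}$ is the Chevalley-Eilenberg differential ($\mathrm{d}\alpha(x,y)=-\alpha([x,y])$ for $\alpha\in\mathfrak{n}^*$, extended as a graded derivation of $\Lambda^\bullet\mathfrak{n}^*$). The symmetric product is $f^i\odot f^j=\frac12(f^i\otimes f^j+f^j\otimes f^i)$. A $\mathrm{G}_2$-structure on a $7$-dimensional real vector space $V$ is a $3$-form $\varphi\in\Lambda^3V^*$ such that $(v\lrcorner\varphi)\wedge(v\lrcorner\varphi)\wedge\varphi\neq0$ for all $v\in V\smallsetminus\{0\}$. It determines a unique inner product $g_\varphi$ and orientation, with volume form $\mathrm{vol}_\varphi$, such that $g_\varphi(v,w)\mathrm{vol}_\varphi=\frac16\,(v\lrcorner\varphi)\wedge(w\lrcorner\varphi)\wedge\varphi$; $*_\varphi$ is the corresponding Hodge operator. A $\mathrm{G}_2$-structure $\varphi$ on $\mathfrak{n}$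 is purely coclosed if $\mathrm{d}*_\varphi\varphi=0$ and $\mathrm{d}\varphi\wedge\varphi=0$. *)

(* Defs.v *)
From HB Require Import structures.
From mathcomp Require Import all_boot all_order all_algebra.
From mathcomp Require Import ring.
From mathcomp Require Import boolp reals.
From mathcomp Require classical_sets.

Set Implicit Arguments.
Unset Strict Implicit.
Unset Printing Implicit Defensive.

Import Order.TTheory GRing.Theory Num.Theory.
Local Open Scope ring_scope.

(* The exterior algebra of the dual of 'rV[R]_n.  With f_0, ..., f_(n-1) the
   standard basis and f^i its dual basis, [alpha A] is the coefficient of
   alpha on f^(i_1) /\ ... /\ f^(i_k), where i_1 < ... < i_k enumerate A. *)
Definition ext (R : nzRingType) (n : nat) := {ffun {set 'I_n} -> R}.
HB.instance Definition _ (R : nzRingType) (n : nat) :=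
  GRing.Lmodule.copy (ext R n) {ffun {set 'I_n} -> R^o}.

Section Exterior.
Variables (R : realType) (n : nat).
Local Notation V := 'rV[R]_n.
Local Notation L := (ext R n).
Implicit Types (A B C : {set 'I_n}) (i j : 'I_n) (v w : V) (a b c : L).

Definition is_form (k : nat) a := forall A, #|A| != k -> a A = 0.

Definition monomial A : L := [ffun B => (B == A)%:R].
Definition covec i : L := monomial [set i].

(* f^B /\ f^C = (-1)^(inversions B C) f^(B :|: C) for disjoint B and C. *)
Definition inversions B C : nat := (\sum_(i in B) \sum_(j in C) (j < i)%N)%N.

Definition wedge a b : L :=
  [ffun A : {set 'I_n} => \sum_(B : {set 'I_n} | B \subset A)
     (-1) ^+ inversions B (A :\: B) * a B * b (A :\: B)].

Definition interior v a : L :=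
  [ffun A : {set 'I_n} => \sum_(i | i \notin A)
     (-1) ^+ inversions [set i] A * v 0 i * a (i |: A)].

(* a(v_1, ..., v_k), for a k-form a and s = [:: v_1; ...; v_k]. *)
Definition eval_form a (s : seq V) : R :=
  foldl (fun c v => interior v c) a s set0.

Definition basis_vec i : V := delta_mx 0 i.

(* A bilinear form on 'rV[R]_n is given by its Gram matrix in the standard
   basis. *)
Definition bil (g : 'M[R]_n) v w : R := (v *m g *m w^T) 0 0.

Definition inner_product (g : 'M[R]_n) :=
  g^T = g /\ forall v, v != 0 -> 0 < bil g v v.

Definition tensor i j : 'M[R]_n := delta_mx i j.
Definition symprod i j : 'M[R]_n := 2^-1 *: (tensor i j + tensor j i).

(* The volume forms of g for its two orientations, that is
   +- sqrt (det g) f^0 /\ ... /\ f^(n-1). *)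
Definition volume_form (g : 'M[R]_n) (vol : L) :=
  is_form n vol /\ vol [set: 'I_n] ^+ 2 = \det g.

(* The vector dual to f^i with respect to g. *)
Definition sharp (g : 'M[R]_n) i : V := row i (invmx g).

(* The inner product induced by g on forms: the sum of a_A b^A, the indices of
   b being raised with g. *)
Definition form_ip (g : 'M[R]_n) a b : R :=
  \sum_(A : {set 'I_n}) a A * eval_form b [seq sharp g i | i <- enum A].

(* The solution of a /\ *b = <a, b>_g vol, see hodgeP. *)
Definition hodge (g : 'M[R]_n) (vol : L) b : L :=
  [ffun A => (-1) ^+ inversions (~: A) A *
     form_ip g (monomial (~: A)) b * vol [set: 'I_n]].

Definition is_lie_bracket (br : V -> V -> V) :=
  [/\ forall t u v w, br (t *: u + v) w = t *: br u w + br v w,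
      forall t u v w, br u (t *: v + w) = t *: br u v + br u w,
      forall v, br v v = 0
    & forall u v w, br u (br v w) + br v (br w u) + br w (br u v) = 0].

(* df^i, the 2-form (x, y) |-> - f^i([x, y]). *)
Definition d_covec (br : V -> V -> V) i : L :=
  \sum_(j : 'I_n) \sum_(k : 'I_n | (j < k)%N)
    - (br (basis_vec j) (basis_vec k)) 0 i *: wedge (covec j) (covec k).

(* The graded derivation extending d_covec, see CE_diff_oneform and
   CE_diff_wedge. *)
Definition CE_diff (br : V -> V -> V) a : L :=
  \sum_i wedge (d_covec br i) (interior (basis_vec i) a).

End Exterior.

Section G2.
Variable R : realType.
Local Notation V := 'rV[R]_7.
Local Notation L := (ext R 7).

Definition G2_structure (phi : L) :=
  is_form 3 phi /\ forall v : V, v != 0 ->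
    wedge (wedge (interior v phi) (interior v phi)) phi != 0.

Definition G2_induces (phi : L) (g : 'M[R]_7) (vol : L) :=
  [/\ inner_product g, volume_form g vol
    & forall v w : V, bil g v w *: vol =
        6^-1 *: wedge (wedge (interior v phi) (interior w phi)) phi].

(* The unique pair (g_phi, vol_phi) induced by phi, see G2_inducesP and
   G2_induces_inj. *)
Definition G2_pair (phi : L) : 'M[R]_7 * L :=
  classical_sets.xget (0, 0) (fun p => G2_induces phi p.1 p.2).
Definition G2_metric (phi : L) : 'M[R]_7 := (G2_pair phi).1.
Definition G2_vol (phi : L) : L := (G2_pair phi).2.
Definition G2_hodge (phi : L) : L -> L := hodge (G2_metric phi) (G2_vol phi).

Definition purely_coclosed (br : V -> V -> V) (phi : L) :=
  CE_diff br (G2_hodge phi phi) = 0 /\ wedge (CE_diff br phi) phi = 0.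

(* ix k, for 1 <= k <= 7, is the index of the k-th basis element. *)
Definition ix (k : nat) : 'I_7 := inord k.-1.

(* The Lie algebra (0,0,0,0,f^12,f^13,0), see n52R2_is_lie_bracket and n52R2_tuple:
   [f_1, f_2] = - f_5 and [f_1, f_3] = - f_6. *)
Definition n52R2_bracket (x y : V) : V :=
  - (x 0 (ix 1) * y 0 (ix 2) - x 0 (ix 2) * y 0 (ix 1)) *: basis_vec R (ix 5)
  - (x 0 (ix 1) * y 0 (ix 3) - x 0 (ix 3) * y 0 (ix 1)) *: basis_vec R (ix 6).

Definition n52R2_metric (E G : R) : 'M[R]_7 :=
  \sum_(1 <= i < 5) symprod R (ix i) (ix i)
  + E *: symprod R (ix 5) (ix 5) + G *: symprod R (ix 6) (ix 6)
  + symprod R (ix 7) (ix 7).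

End G2.

Section ExteriorTheory.
Variables (R : realType) (n : nat).
Local Notation V := 'rV[R]_n.
Local Notation L := (ext R n).
Implicit Types (A B C D : {set 'I_n}) (i j : 'I_n) (v w : V) (a b c : L).

Lemma inversionsUl B C D : [disjoint B & C] ->
  inversions (B :|: C) D = (inversions B D + inversions C D)%N.
Proof.
move=> dBC; rewrite /inversions (eq_bigl [predU B & C]) ?bigU // => i.
by rewrite !inE.
Qed.

Lemma inversionsUr B C D : [disjoint C & D] ->
  inversions B (C :|: D) = (inversions B C + inversions B D)%N.
Proof.
move=> dCD; rewrite /inversions -big_split /=; apply: eq_bigr => i _.
rewrite (eq_bigl [predU C & D]) ?bigU // => j.
by rewrite !inE.
Qed.

Lemma inversionsC B C : [disjoint B & C] ->
  (inversions B C + inversions C B = #|B| * #|C|)%N.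
Proof.
move=> dBC; rewrite /inversions [in X in (_ + X)%N]exchange_big /= -big_split /=.
rewrite -sum_nat_const; apply: eq_bigr => i iB; rewrite -big_split /=.
rewrite -sum1_card; apply: eq_bigr => j jC.
have : i != j by apply: contraTneq iB => ->; rewrite (disjointFl dBC).
by rewrite -val_eqE /=; case: ltngtP.
Qed.

Lemma signr_inversionsC B C : [disjoint B & C] ->
  (-1) ^+ inversions B C = (-1) ^+ (#|B| * #|C|) * (-1) ^+ inversions C B :> R.
Proof.
move=> dBC; rewrite -(inversionsC dBC) exprD -mulrA -exprD addnn -muln2.
by rewrite exprM sqrr_sign mulr1.
Qed.

Lemma ext_scaleE (t : R) a A : (t *: a) A = t * a A.
Proof. by rewrite ffunE. Qed.

Lemma ext_addE a b A : (a + b) A = a A + b A.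
Proof. by rewrite ffunE. Qed.

Lemma ext_oppE a A : (- a) A = - a A.
Proof. by rewrite ffunE. Qed.

Lemma ext_sumE (I : Type) (r : seq I) (P : pred I) (F : I -> L) A :
  (\sum_(k <- r | P k) F k) A = \sum_(k <- r | P k) F k A.
Proof. by apply: (big_morph (fun a : L => a A)) => [a b|]; rewrite ffunE. Qed.

Lemma ext_monomialE a : a = \sum_A a A *: monomial R A.
Proof.
apply/ffunP => B; rewrite ext_sumE (bigD1 B) //= ext_scaleE ffunE eqxx mulr1.
rewrite big1 ?addr0 // => A nAB.
by rewrite ext_scaleE ffunE eq_sym (negPf nAB) mulr0.
Qed.

Lemma wedge_linearr a (t : R) b c :
  wedge a (t *: b + c) = t *: wedge a b + wedge a c.
Proof.
apply/ffunP => A; rewrite ext_addE ext_scaleE !ffunE mulr_sumr -big_split /=.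
apply: eq_bigr => B _; rewrite ext_addE ext_scaleE mulrDr; congr (_ + _).
by rewrite mulrCA.
Qed.

Lemma wedge_linearl a (t : R) b c :
  wedge (t *: b + c) a = t *: wedge b a + wedge c a.
Proof.
apply/ffunP => A; rewrite ext_addE ext_scaleE !ffunE mulr_sumr -big_split /=.
apply: eq_bigr => B _; rewrite ext_addE ext_scaleE mulrDr mulrDl.
by congr (_ + _); rewrite mulrCA -!mulrA.
Qed.

HB.instance Definition _ a :=
  GRing.isLinear.Build R L L _ (wedge a) (wedge_linearr a).

Lemma wedge0 a : wedge a 0 = 0. Proof. exact: linear0. Qed.
Lemma wedgeDr a b c : wedge a (b + c) = wedge a b + wedge a c.
Proof. exact: linearD. Qed.
Lemma wedgeZr (t : R) a c : wedge a (t *: c) = t *: wedge a c.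
Proof. exact: linearZ. Qed.
Lemma wedge0l a : wedge 0 a = 0.
Proof. by apply/ffunP => A; rewrite !ffunE big1 // => B _; rewrite ffunE mulr0 mul0r. Qed.
Lemma wedgeDl a b c : wedge (a + b) c = wedge a c + wedge b c.
Proof. by have := wedge_linearl c 1 a b; rewrite !scale1r. Qed.
Lemma wedgeZl (t : R) a c : wedge (t *: a) c = t *: wedge a c.
Proof. by have := wedge_linearl c t a 0; rewrite !addr0 wedge0l addr0. Qed.
Lemma wedge_suml (I : Type) (r : seq I) (P : pred I) (F : I -> L) c :
  wedge (\sum_(k <- r | P k) F k) c = \sum_(k <- r | P k) wedge (F k) c.
Proof.
exact: (big_morph (fun a => wedge a c) (fun a b => wedgeDl a b c) (wedge0l c)).
Qed.

Lemma wedge_sumr a (I : Type) (r : seq I) (P : pred I) (F : I -> L) :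
  wedge a (\sum_(k <- r | P k) F k) = \sum_(k <- r | P k) wedge a (F k).
Proof. exact: linear_sum. Qed.

Lemma interior_linear v : linear (interior v).
Proof.
move=> t a b; apply/ffunP => A; rewrite ext_addE ext_scaleE !ffunE mulr_sumr.
rewrite -big_split /=; apply: eq_bigr => i _.
by rewrite ext_addE ext_scaleE mulrDr; congr (_ + _); rewrite mulrCA.
Qed.

HB.instance Definition _ v :=
  GRing.isLinear.Build R L L _ (interior v) (interior_linear v).

Lemma interiorZ v (t : R) a : interior v (t *: a) = t *: interior v a.
Proof. exact: linearZ. Qed.
Lemma interiorD v a b : interior v (a + b) = interior v a + interior v b.
Proof. exact: linearD. Qed.
Lemma interiorB v a b : interior v (a - b) = interior v a - interior v b.
Proof. exact: linearB. Qed.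

Lemma interiorE v a : interior v a = \sum_i v 0 i *: interior (basis_vec R i) a.
Proof.
apply/ffunP => A; rewrite ext_sumE ffunE big_mkcond /=.
apply: eq_bigr => i _; rewrite ext_scaleE ffunE.
case: ifP => iA; last first.
  rewrite big1 ?mulr0 // => j jA; rewrite mxE eqxx /=.
  by have [jEi|_] := eqVneq j i; [rewrite jEi iA in jA | rewrite mulr0 mul0r].
rewrite (bigD1 i) //= mxE !eqxx mulr1 big1 ?addr0 => [|j /andP[_ /negPf nji]].
  by rewrite mulrCA mulrA.
by rewrite mxE eqxx nji mulr0 mul0r.
Qed.

Lemma interior_basis i a A : interior (basis_vec R i) a A =
  if i \in A then 0 else (-1) ^+ inversions [set i] A * a (i |: A).
Proof.
rewrite ffunE; case: ifP => iA.
  rewrite big1 // => j jA; rewrite mxE eqxx /=.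
  by have [jEi|_] := eqVneq j i; [rewrite jEi iA in jA | rewrite mulr0 mul0r].
rewrite (bigD1 i) ?iA //= mxE !eqxx mulr1 big1 ?addr0 // => j /andP[_ /negPf nji].
by rewrite mxE eqxx nji mulr0 mul0r.
Qed.

Lemma wedge_form k l a b :
  is_form k a -> is_form l b -> is_form (k + l) (wedge a b).
Proof.
move=> ka lb A nA; rewrite ffunE big1 // => B sBA.
have [kB|nB] := eqVneq #|B| k; last by rewrite ka // mulr0 mul0r.
rewrite lb ?mulr0 //; apply: contra_neq nA => lAB.
by rewrite -(cardsID B A) (setIidPr sBA) kB lAB.
Qed.

Lemma interior_form k v a : is_form k.+1 a -> is_form k (interior v a).
Proof.
move=> ka A nA; rewrite ffunE big1 // => i iA.
by rewrite ka ?mulr0 // cardsU1 iA.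
Qed.

Lemma covec_form i : is_form 1 (covec R i).
Proof.
by move=> A nA; rewrite ffunE; case: eqP => // AE; rewrite AE cards1 in nA.
Qed.

Lemma wedgeC k l a b : is_form k a -> is_form l b ->
  wedge a b = (-1) ^+ (k * l) *: wedge b a.
Proof.
move=> ka lb; apply/ffunP => A; rewrite ext_scaleE !ffunE mulr_sumr.
rewrite (reindex_onto (fun B => A :\: B) (fun B => A :\: B)) /=; last first.
  by move=> B sBA; rewrite setDDr setDv set0U (setIidPr sBA).
apply: eq_big => [B|B].
  rewrite subsetDl /= setDDr setDv set0U; apply/eqP/idP => [<-|/setIidPr //].
  exact: subsetIl.
rewrite subsetDl /= setDDr setDv set0U => /eqP ->.
have [lB|nB] := eqVneq #|B| l; last by rewrite lb // !mulr0 mul0r mulr0.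
have [kB|nB] := eqVneq #|A :\: B| k; last by rewrite ka // !mulr0 mul0r.
rewrite signr_inversionsC ?kB ?lB; first by rewrite -!mulrA; congr (_ * _);
  rewrite [b B * _]mulrC.
by rewrite -setI_eq0 setIDAC setDIl setDv setI0.
Qed.

Lemma wedgeA a b c : wedge a (wedge b c) = wedge (wedge a b) c.
Proof.
apply/ffunP => A; rewrite !ffunE.
transitivity (\sum_(B : {set 'I_n} | B \subset A) \sum_(D : {set 'I_n} | (B \subset D) && (D \subset A))
  ((-1) ^+ (inversions D (A :\: D) + inversions B (D :\: B))
     * a B * b (D :\: B) * c (A :\: D))); last first.
  rewrite (exchange_big_dep (fun D : {set 'I_n} => D \subset A)) /=; last by move=> B D _ /andP[].
  apply: eq_bigr => D sDA; rewrite ffunE mulr_sumr mulr_suml.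
  apply: eq_big => [B|B _].
    by rewrite sDA andbT; apply: andb_idl => /subset_trans; apply.
  by rewrite exprD !mulrA.
apply: eq_bigr => B sBA; rewrite ffunE mulr_sumr.
rewrite [RHS](reindex_onto (fun C : {set 'I_n} => B :|: C) (fun D : {set 'I_n} => D :\: B)) /=; last first.
  by move=> D /andP[sBD _]; rewrite -{2}(setID D B) (setIidPr sBD).
apply: eq_big => [C|C sC].
  rewrite subsetUl subUset sBA subsetD /=; congr (_ && _).
  rewrite setDUl setDv set0U; apply/idP/eqP => [dCB|<-].
    by apply/setDidPl.
  by rewrite -setI_eq0 setIDAC -setIDA setDv setI0.
have [sCA dCB] := subsetDP sC.
have -> : (B :|: C) :\: B = C by rewrite setDUl setDv set0U; apply/setDidPl.
have -> : A :\: (B :|: C) = A :\: B :\: C by rewrite setDDl.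
have {1}-> : A :\: B = C :|: (A :\: B :\: C).
  by rewrite -[LHS](setID _ C) (setIidPr sC).
rewrite inversionsUr; last first.
  by rewrite -setI_eq0 setIC setIDAC -setIDA setDv setI0.
rewrite inversionsUl ?(disjoint_sym B) // !exprD; ring.
Qed.

Lemma interior_wedge k v a b : is_form k a ->
  interior v (wedge a b) =
    wedge (interior v a) b + (-1) ^+ k *: wedge a (interior v b).
Proof.
move=> ka; rewrite interiorE (interiorE v a) (interiorE v b).
rewrite wedge_suml linear_sum scaler_sumr -big_split /=; apply: eq_bigr => i _.
rewrite wedgeZl linearZ /= scalerA [_ * v 0 i]mulrC -scalerA -scalerDr; congr (_ *: _).
apply/ffunP => A; rewrite ext_addE ext_scaleE interior_basis !ffunE.
have D1 B : i \notin B -> (i |: B) :\ i = B by move=> iB; rewrite setU1K.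
have dis B : i \notin B -> [disjoint [set i] & B] by rewrite disjoints1.
have U1 B C : i \notin B -> inversions (i |: B) C = (inversions [set i] C + inversions B C)%N.
  by move=> iB; rewrite inversionsUl ?dis.
have U2 B C : i \notin C -> inversions B (i |: C) = (inversions B [set i] + inversions B C)%N.
  by move=> iC; rewrite inversionsUr ?dis.
have S B : i \notin B ->
    (-1) ^+ inversions B [set i] = (-1) ^+ #|B| * (-1) ^+ inversions [set i] B :> R.
  by move=> iB; rewrite signr_inversionsC ?cards1 ?muln1 // disjoint_sym dis.
have sq m : (-1) ^+ m * (-1) ^+ m = 1 :> R by rewrite -expr2 sqrr_sign.
case: ifP => iA.
  rewrite (bigID (fun B : {set 'I_n} => i \in B)) /= big1 ?add0r; last first.
    by move=> B /andP[_ iB]; rewrite interior_basis iB mulr0 mul0r.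
  rewrite [X in _ + _ * X](bigID (fun B : {set 'I_n} => i \in B)) /= [X in _ + _ * (_ + X)]big1 ?addr0; last first.
    by move=> B /andP[_ iB]; rewrite interior_basis !inE iA iB /= mulr0.
  rewrite [X in _ * X](reindex_onto (fun B => i |: B) (fun B => B :\ i)) /=; last first.
    by move=> B /andP[_ iB]; rewrite setD1K.
  rewrite mulr_sumr.
  pose P := fun B : {set 'I_n} => (B \subset A) && (i \notin B).
  rewrite [X in _ + X](eq_bigl P) => [|B]; last first.
    rewrite /P subUset sub1set iA setU11 andbT /=; congr (_ && _).
    by apply/eqP/idP => [<-|/D1 //]; rewrite !inE eqxx.
  rewrite -big_split big1 //= => B /andP[sBA iB].
  rewrite !interior_basis (negPf iB) !inE eqxx /=.
  have iC : i \notin A :\: (i |: B) by rewrite !inE eqxx.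
  have E : A :\: B = i |: (A :\: (i |: B)).
    by rewrite [i |: B]setUC -setDDl setD1K // inE iB.
  rewrite -E; have [kB|nB] := eqVneq #|i |: B| k; last by rewrite ka //; ring.
  rewrite {1}E U2 // U1 // !exprD S // -kB cardsU1 iB exprS.
  have := sq #|B|; have := sq (inversions [set i] B).
  have := sq (inversions [set i] (A :\: (i |: B))).
  set x := (-1) ^+ _; set y := (-1) ^+ _; set z := (-1) ^+ _; set t := (-1) ^+ _.
  move=> hx hy hz.
  transitivity (z * t * a (i |: B) * b (A :\: B) * (y * y - (x * x))); first by ring.
  by rewrite hx hy subrr mulr0.
rewrite !mulr_sumr (bigID (fun B : {set 'I_n} => i \in B)) /=; congr (_ + _).
  rewrite (reindex_onto (fun B => i |: B) (fun B => B :\ i)) /=; last first.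
    by move=> B /andP[_ iB]; rewrite setD1K.
  apply: eq_big => [B|B].
    rewrite subUset sub1set !setU11 andbT /=.
    apply/andP/idP => [[sB /eqP iB]|sB].
      move: iB; have [iB|] := boolP (i \in B); last first.
        move=> iB _; apply/subsetP => j jB; have /(subsetP sB) := jB.
        by rewrite !inE => /orP[/eqP jEi|//]; rewrite jEi (negPf iB) in jB.
      by move=> /setP/(_ i); rewrite iB !inE eqxx.
    split; first exact: subset_trans sB (subsetUr _ _).
    by apply/eqP/D1; apply: contraFN iA => /(subsetP sB).
  move=> /andP[/andP[sB _] /eqP iBB].
  have iB : i \notin B by rewrite -iBB !inE eqxx.
  have E : (i |: A) :\: (i |: B) = A :\: B.
    apply/setP => j; rewrite !inE; case: eqVneq => //= ->.
    by rewrite iA andbF.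
  rewrite E interior_basis (negPf iB).
  have sBA : B \subset A.
    apply/subsetP => j jB; have /(subsetP sB) : j \in i |: B by rewrite !inE jB orbT.
    by rewrite !inE => /orP[/eqP jEi|//]; rewrite -jEi jB in iB.
have -> : inversions [set i] A =
    (inversions [set i] B + inversions [set i] (A :\: B))%N.
  rewrite -inversionsUr; first by rewrite -{1}(setID A B) (setIidPr sBA).
  by rewrite -setI_eq0 setIC setIDAC -setIDA setDv setI0.
  rewrite U1 // !exprD; have := sq (inversions [set i] (A :\: B)).
  set x := (-1) ^+ _; set y := (-1) ^+ _; set z := (-1) ^+ _ => hx.
  transitivity ((x * x) * (y * z * a (i |: B) * b (A :\: B))); first by ring.
  by rewrite hx; ring.
apply: eq_big => [B|B /andP[sB iB]].
  apply/andP/idP => [[sB iB]|sB].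
    apply/subsetP => j jB; have /(subsetP sB) := jB.
    by rewrite !inE => /orP[/eqP jEi|//]; rewrite jEi (negPf iB) in jB.
  split; first exact: subset_trans sB (subsetUr _ _).
  by apply: contraFN iA => /(subsetP sB).
have sBA : B \subset A.
  apply/subsetP => j jB; have /(subsetP sB) := jB.
  by rewrite !inE => /orP[/eqP jEi|//]; rewrite jEi (negPf iB) in jB.
have E : (i |: A) :\: B = i |: (A :\: B).
  apply/setP => j; rewrite !inE; case: eqVneq => //= ->.
  by rewrite iB.
have iC : i \notin A :\: B by rewrite !inE iA andbF.
rewrite interior_basis (negPf iC) E U2 //.
have -> : inversions [set i] A =
    (inversions [set i] B + inversions [set i] (A :\: B))%N.
  rewrite -inversionsUr; first by rewrite -{1}(setID A B) (setIidPr sBA).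
  by rewrite -setI_eq0 setIC setIDAC -setIDA setDv setI0.
have [kB|nB] := eqVneq #|B| k; last by rewrite ka //; ring.
rewrite !exprD S // kB; have := sq (inversions [set i] B).
set x := (-1) ^+ _; set y := (-1) ^+ _; set z := (-1) ^+ _; set t := (-1) ^+ _ => hx.
transitivity ((x * x) * (y * z * t * a B * b (i |: (A :\: B)))); first by ring.
by rewrite hx; ring.
Qed.

Variable br : V -> V -> V.

Lemma d_covec_form i : is_form 2 (d_covec br i).
Proof.
move=> A nA; rewrite ext_sumE big1 // => j _; rewrite ext_sumE big1 // => k _.
by rewrite ext_scaleE (wedge_form (@covec_form j) (@covec_form k)) // mulr0.
Qed.

Lemma CE_diff_wedge k a b : is_form k a ->
  CE_diff br (wedge a b) =
    wedge (CE_diff br a) b + (-1) ^+ k *: wedge a (CE_diff br b).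
Proof.
move=> ka; rewrite /CE_diff wedge_suml linear_sum scaler_sumr -big_split /=.
apply: eq_bigr => i _; rewrite (interior_wedge _ _ ka) linearD linearZ /= !wedgeA.
by rewrite (wedgeC (@d_covec_form i) ka) mulnC exprM sqrr_sign scale1r.
Qed.

Local Notation one := (monomial R set0).

Lemma wedge1l a : wedge one a = a.
Proof.
apply/ffunP => A; rewrite ffunE (bigD1 set0) ?sub0set //= big1 => [|B /andP[_ nB]].
  by rewrite ffunE eqxx /inversions big_set0 setD0 !mul1r addr0.
by rewrite ffunE (negPf nB) mulr0 mul0r.
Qed.

Lemma wedge1r a : wedge a one = a.
Proof.
apply/ffunP => A; rewrite ffunE (bigD1 A) //= big1 => [|B /andP[sBA nB]].
  rewrite ffunE setDv eqxx /inversions big1 ?mul1r ?mulr1 ?addr0 // => i _.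
  by rewrite big_set0.
rewrite ffunE; case: eqP => [/eqP|_]; last by rewrite mulr0.
by rewrite setD_eq0 => sAB; rewrite eqEsubset sBA sAB in nB.
Qed.

Lemma interior_one v : interior v one = 0.
Proof.
apply/ffunP => A; rewrite !ffunE big1 // => i _; rewrite ffunE.
case: eqP => [/setP/(_ i)|_]; last by rewrite mulr0.
by rewrite !inE eqxx.
Qed.

Lemma interior_covec v i : interior v (covec R i) = v 0 i *: one.
Proof.
rewrite interiorE (bigD1 i) //= big1 ?addr0 => [|j nji].
  congr (_ *: _); apply/ffunP => A; rewrite interior_basis !ffunE.
  have [->|nA] := eqVneq A set0.
    by rewrite setU0 inE eqxx mulr1 /inversions big1 // => j _; rewrite big_set0.
  case: ifP => // iA; case: eqP => [E|_]; last by rewrite mulr0.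
  case/eqP: nA; apply/setP => j; rewrite inE; apply/negP => jA.
  have : j \in i |: A by rewrite !inE jA orbT.
  by rewrite E inE => /eqP jEi; rewrite -jEi jA in iA.
rewrite -[RHS](scaler0 _ (v 0 j)); congr (_ *: _); apply/ffunP => A.
rewrite interior_basis !ffunE; case: ifP => // _.
case: eqP => [/setP/(_ j)|_]; last by rewrite mulr0.
by rewrite !inE eqxx (negPf nji).
Qed.

Lemma form0E a : is_form 0 a -> a = a set0 *: one.
Proof.
move=> fa; apply/ffunP => A; rewrite ext_scaleE ffunE.
have [->|nA] := eqVneq A set0; first by rewrite mulr1.
by rewrite mulr0 fa ?cards_eq0.
Qed.

Lemma CE_diff_covec i : CE_diff br (covec R i) = d_covec br i.
Proof.
rewrite /CE_diff (bigD1 i) //= big1 ?addr0 => [|j nji].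
  by rewrite interior_covec mxE !eqxx scale1r wedge1r.
by rewrite interior_covec mxE eqxx eq_sym (negPf nji) scale0r wedge0.
Qed.

Lemma eval_form1 a x : eval_form a [:: x] = \sum_i x 0 i * a [set i].
Proof.
rewrite /eval_form /= ffunE big_mkcond; apply: eq_bigr => i _.
rewrite inE /= setU0 /inversions big1 ?mul1r // => j _.
by rewrite big_set0.
Qed.

Lemma interior_wedge_covec x j k :
  interior x (wedge (covec R j) (covec R k)) = x 0 j *: covec R k - x 0 k *: covec R j.
Proof.
rewrite (interior_wedge _ _ (@covec_form j)) !interior_covec wedgeZl wedge1l.
by rewrite linearZ /= wedge1r expr1 scaleN1r.
Qed.

Lemma CE_diff_form1 a : is_form 1 a -> CE_diff br a = \sum_i a [set i] *: d_covec br i.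
Proof.
move=> fa; apply: eq_bigr => i _.
rewrite [interior _ a]form0E; last exact: interior_form.
rewrite linearZ /= wedge1r interior_basis inE setU0 /inversions big1 ?mul1r // => j _.
by rewrite big_set0.
Qed.

Lemma linear_rV (f : V -> V) : linear f -> forall x, f x = \sum_j x 0 j *: f (basis_vec R j).
Proof.
move=> fl x; have f0 : f 0 = 0.
  by have := fl (-1) 0 0; rewrite scaler0 addr0 scaleN1r addNr.
rewrite {1}[x]row_sum_delta; elim: (index_enum _) => [|j r IHr].
  by rewrite !big_nil.
by rewrite !big_cons fl IHr.
Qed.

Lemma lie_bracket_basis x y : is_lie_bracket br ->
  br x y = \sum_j \sum_k (x 0 j * y 0 k) *: br (basis_vec R j) (basis_vec R k).
Proof.
move=> [bl br' _ _]; rewrite (@linear_rV (fun u => br u y)) => [|t u w]; last exact: bl.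
apply: eq_bigr => j _; rewrite (@linear_rV (br _)) => [|t u w]; last exact: br'.
by rewrite scaler_sumr; apply: eq_bigr => k _; rewrite scalerA.
Qed.

Lemma CE_diff_oneform a x y : is_lie_bracket br -> is_form 1 a ->
  eval_form (CE_diff br a) [:: x; y] = - eval_form a [:: br x y].
Proof.
move=> lie fa; rewrite CE_diff_form1 // eval_form1 /eval_form /= !linear_sum /=.
rewrite ext_sumE -sumrN; apply: eq_bigr => i _.
rewrite !linearZ /= ext_scaleE mulrC -mulNr; congr (_ * _).
have [_ bir alt _] := lie.
have anti u v : br v u = - br u v.
  have [bil_ _ _ _] := lie.
  have := alt (u + v); have := bil_ 1 u v (u + v); rewrite !scale1r => ->.
  have := bir 1 u u v; have := bir 1 v u v; rewrite !scale1r => -> ->.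
  by rewrite !alt add0r addr0 => /eqP; rewrite addrC addr_eq0 => /eqP.
rewrite /d_covec !linear_sum /= ext_sumE lie_bracket_basis // summxE.
pose T j k := x 0 j * y 0 k * br (basis_vec R j) (basis_vec R k) 0 i.
transitivity (- \sum_(j < n) \sum_(k : 'I_n | (j < k)%N) (T j k + T k j)).
  rewrite -sumrN; apply: eq_bigr => j _; rewrite !linear_sum /= ext_sumE -sumrN.
  apply: eq_bigr => k _; rewrite !interiorZ interior_wedge_covec ext_scaleE.
  rewrite interiorB !interiorZ !interior_covec ext_addE ext_oppE !ext_scaleE ffunE eqxx /T.
  by rewrite (anti (basis_vec R j)) [(- br _ _) 0 i]mxE !mulr1; ring.
congr (- _); transitivity (\sum_(j < n) \sum_(k < n) T j k); last first.
  by apply: eq_bigr => j _; rewrite summxE; apply: eq_bigr => k _; rewrite mxE.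
transitivity (\sum_(j < n) \sum_(k : 'I_n | (j < k)%N) T j k
    + \sum_(j < n) \sum_(k : 'I_n | (k < j)%N) T j k).
  rewrite [X in _ = _ + X](exchange_big_dep xpredT) //= -big_split /=.
  by apply: eq_bigr => j _; rewrite -big_split.
rewrite -big_split; apply: eq_bigr => j _ /=.
rewrite [RHS](bigID (fun k : 'I_n => (j < k)%N)) /=; congr (_ + _).
rewrite [RHS](bigD1 j) ?ltnn //= (_ : T j j = 0) ?add0r; last by rewrite /T alt mxE mulr0.
by apply: eq_bigl => k; rewrite -leqNgt -val_eqE /= ltn_neqAle andbC.
Qed.

Lemma eval_form0 (s : seq V) : eval_form (0 : L) s = 0.
Proof. by rewrite /eval_form; elim: s => [|v s IHs] /=; rewrite ?ffunE ?linear0. Qed.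

Lemma eval_form_size k a (s : seq V) : is_form k a -> size s != k -> eval_form a s = 0.
Proof.
elim: s k a => [|v s IHs] [|k] a fa //= ns.
- by rewrite /eval_form /= fa // cards0 eq_sym.
- have -> : eval_form a (v :: s) = eval_form (interior v a) s by [].
  rewrite [a]form0E // linearZ /= interior_one scaler0; exact: eval_form0.
- by apply: (IHs k) => //; apply: interior_form.
Qed.

Lemma form_ip_monomial (g : 'M[R]_n) A b :
  form_ip g (monomial R A) b = eval_form b [seq sharp g i | i <- enum A].
Proof.
rewrite /form_ip (bigD1 A) //= big1 ?addr0 => [|B nB]; first by rewrite ffunE eqxx mul1r.
by rewrite ffunE (negPf nB) mul0r.
Qed.

Lemma top_formE a : is_form n a -> a = a setT *: monomial R setT.
Proof.
move=> fa; apply/ffunP => A; rewrite ext_scaleE ffunE.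
have [->|nA] := eqVneq A setT; first by rewrite mulr1.
rewrite mulr0 fa //; apply: contra_neq nA => cA; apply/eqP.
by rewrite eqEcard subsetT cardsT card_ord cA leqnn.
Qed.

Lemma hodgeP k (g : 'M[R]_n) vol a b : is_form n vol ->
  is_form k a -> is_form k b -> wedge a (hodge g vol b) = form_ip g a b *: vol.
Proof.
move=> fvol fa fb; apply/ffunP => A; rewrite ext_scaleE.
have [->|nA] := eqVneq A setT.
  rewrite ffunE (eq_bigl xpredT) => [|B]; last exact: subsetT.
  rewrite /form_ip mulr_suml; apply: eq_bigr => B _.
  rewrite ffunE setTD setCK form_ip_monomial.
  have := sqrr_sign R (inversions B (~: B)); rewrite expr2.
  set x := (-1) ^+ _ => hx.
  transitivity ((x * x) * (a B * eval_form b [seq sharp g i | i <- enum B] * vol setT)).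
    by ring.
  by rewrite hx mul1r.
have cA : #|A| != n.
  apply: contra_neq nA => cA; apply/eqP.
  by rewrite eqEcard subsetT cardsT card_ord cA leqnn.
rewrite fvol // mulr0 ffunE big1 // => B sBA.
have [kB|nB] := eqVneq #|B| k; last by rewrite fa // mulr0 mul0r.
rewrite ffunE form_ip_monomial (eval_form_size fb) ?(mulr0, mul0r) //.
rewrite size_map -cardE; apply: contra cA => /eqP ck.
have := cardsC (A :\: B); rewrite ck -kB card_ord => nE; apply/eqP/(etrans _ nE).
by rewrite -(cardsID B A) (setIidPr sBA) addnC.
Qed.

Lemma det_gt0 (M : 'M[R]_n) :
  (forall v, v != 0 -> 0 < bil M v v) -> 0 < \det M.
Proof.
move=> pos; rewrite ltNge; apply/negP => dM.
pose N t : 'M[R]_n := 1%:M + t *: (M - 1%:M).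
pose p := \det (\matrix_(i, j) ((1%:M i j : R)%:P + (M i j - 1%:M i j) *: 'X)).
have pE t : (- p).[t] = - \det (N t).
  rewrite hornerN -[p.[t]]/(horner_eval t p) -det_map_mx; congr (- \det _).
  apply/matrixP => i j; rewrite !mxE /= /horner_eval hornerD hornerC hornerZ hornerX.
  by rewrite mulrC.
have [||t /andP[t0 t1]] := @poly_ivt R (- p) 0 1; first exact: ler01.
  rewrite !pE /N scale0r addr0 det1 scale1r addrC subrK oppr_ge0 dM andbT.
  by rewrite lerNl oppr0 ler01.
rewrite /root pE oppr_eq0 => /det0P[v v0 vN].
have : bil (N t) v v = 0 by rewrite /bil vN mul0mx mxE.
have -> : bil (N t) v v = (1 - t) * bil 1%:M v v + t * bil M v v.
  rewrite /bil /N scalerBr mulmxDr mulmxBr -!scalemxAr mulmxDl mulmxBl -!scalemxAl.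
  by rewrite !mxE; ring.
have v1 : 0 < bil 1%:M v v.
  rewrite /bil mulmx1 mxE lt_def psumr_neq0 => [|i _]; last by rewrite mxE -expr2 sqr_ge0.
  rewrite sumr_ge0 ?andbT => [|i _]; last by rewrite mxE -expr2 sqr_ge0.
  have /rV0Pn[i vi] := v0; apply/hasP; exists i; first exact: mem_index_enum.
  by rewrite /= mxE -expr2 lt_def sqrf_eq0 vi sqr_ge0.
have := pos v v0; move: v1; set x := bil _ _ _; set y := bil _ _ _ => x0 y0 /eqP.
apply/negP; rewrite gt_eqF //.
have [->|t_neq0] := eqVneq t 0; first by rewrite subr0 mul1r mul0r addr0.
by rewrite ltr_wpDl ?mulr_ge0 ?subr_ge0 // ?mulr_gt0 // ?lt_def ?t_neq0 // ltW.
Qed.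

End ExteriorTheory.

Section G2Theory.
Variable R : realType.
Local Notation V := 'rV[R]_7.
Local Notation L := (ext R 7).
Implicit Types (v w : V) (phi vol : L) (g : 'M[R]_7).

Lemma bil_delta g i j : bil g (basis_vec R i) (basis_vec R j) = g i j.
Proof. by rewrite /bil -rowE trmx_delta -colE !mxE. Qed.

Lemma bilE g v w : bil g v w = \sum_i \sum_j v 0 i * w 0 j * g i j.
Proof.
rewrite /bil mxE exchange_big /=; apply: eq_bigr => j _; rewrite !mxE mulr_suml.
by apply: eq_bigr => i _; ring.
Qed.

Definition G2_form phi v w : L :=
  6^-1 *: wedge (wedge (interior v phi) (interior w phi)) phi.

Lemma G2_form_top phi v w : is_form 3 phi -> is_form 7 (G2_form phi v w).
Proof.
move=> f3 A nA; rewrite /G2_form ext_scaleE (@wedge_form _ _ 4 3) ?mulr0 //.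
by apply: (@wedge_form _ _ 2 2) => //; apply: interior_form.
Qed.

Lemma G2_formE phi v w :
  G2_form phi v w = \sum_i \sum_j (v 0 i * w 0 j) *: G2_form phi (basis_vec R i) (basis_vec R j).
Proof.
rewrite /G2_form (interiorE v) !wedge_suml scaler_sumr; apply: eq_bigr => i _.
rewrite (interiorE w) wedge_sumr wedge_suml scaler_sumr; apply: eq_bigr => j _.
by rewrite !(wedgeZl, wedgeZr) !scalerA; congr (_ *: _); ring.
Qed.

Definition G2_mx phi : 'M[R]_7 :=
  \matrix_(i, j) G2_form phi (basis_vec R i) (basis_vec R j) setT.

Lemma G2_mxE phi v w : bil (G2_mx phi) v w = G2_form phi v w setT.
Proof.
rewrite bilE G2_formE ext_sumE; apply: eq_bigr => i _; rewrite ext_sumE.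
by apply: eq_bigr => j _; rewrite ext_scaleE mxE.
Qed.

Lemma G2_mx_sym phi : is_form 3 phi -> (G2_mx phi)^T = G2_mx phi.
Proof.
move=> f3; apply/matrixP => i j; rewrite !mxE /G2_form [wedge (interior _ _) _](@wedgeC _ _ 2 2).
- by rewrite -signr_odd scale1r.
- exact: interior_form.
- exact: interior_form.
Qed.

Lemma bilZ (t : R) g v w : bil (t *: g) v w = t * bil g v w.
Proof. by rewrite /bil -scalemxAr -scalemxAl mxE. Qed.

Lemma G2_induces_scale phi g vol : G2_induces phi g vol -> G2_mx phi = vol setT *: g.
Proof.
move=> [_ _ gE]; apply/matrixP => i j; rewrite mxE /G2_form -gE ext_scaleE bil_delta.
by rewrite mxE mulrC.
Qed.

Lemma G2_induces_det phi g vol : G2_induces phi g vol ->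
  0 < \det g /\ vol setT ^+ 9 = \det (G2_mx phi).
Proof.
move=> ind; rewrite (G2_induces_scale ind) detZ.
case: ind => [[_ pos] [_ vg] _]; split; first exact: det_gt0.
by rewrite -vg -exprD.
Qed.

Lemma expr9_inj (x y : R) : x ^+ 9 = y ^+ 9 -> x = y.
Proof.
move=> E; have : `|x| ^+ 9 = `|y| ^+ 9 by rewrite -!normrX E.
move/(pexpIrn (isT : (0 < 9)%N)); rewrite !nnegrE !normr_ge0 => /(_ isT isT) nE.
have : Num.sg x = Num.sg y.
  have s (z : R) : Num.sg (z ^+ 9) = Num.sg z by rewrite sgrX; case: (sgrP z) => _; rewrite ?expr0n ?expr1n // -signr_odd.
  by rewrite -s E s.
by move=> sE; rewrite (numEsg x) (numEsg y) nE sE.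
Qed.

Lemma G2_induces_inj phi g vol g' vol' :
  G2_induces phi g vol -> G2_induces phi g' vol' -> g = g' /\ vol = vol'.
Proof.
move=> ind ind'; have [dg vg] := G2_induces_det ind.
have [_ vg'] := G2_induces_det ind'.
have cE : vol setT = vol' setT by apply: expr9_inj; rewrite vg vg'.
have [_ [fvol volg] _] := ind; have [_ [fvol' _] _] := ind'.
split; last by rewrite (top_formE fvol) (top_formE fvol') cE.
have c0 : vol setT != 0 by rewrite -sqrf_eq0 volg gt_eqF.
apply: (scalerI c0); rewrite -(G2_induces_scale ind) cE.
exact: G2_induces_scale ind'.
Qed.

Lemma bilC g v w : g^T = g -> bil g v w = bil g w v.
Proof.
move=> sg; rewrite /bil; set M := v *m g *m w^T.
have -> : M 0 0 = M^T 0 0 by rewrite [RHS]mxE.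
by rewrite /M !trmx_mul trmxK sg mulmxA.
Qed.

Lemma bil_quad g v w (t : R) : g^T = g ->
  bil g (w + t *: v) (w + t *: v) = bil g w w + 2 * t * bil g v w + t ^+ 2 * bil g v v.
Proof.
move=> sg; have := bilC w v sg; rewrite /bil linearD linearZ /=.
rewrite !mulmxDl !mulmxDr -!scalemxAl -!scalemxAr !mxE => ->; ring.
Qed.

Lemma definite_bil g : g^T = g -> (forall v, v != 0 -> bil g v v != 0) ->
  exists s : bool, forall v, v != 0 -> 0 < bil ((-1) ^+ s *: g) v v.
Proof.
move=> sg nz; have [[v [v0 qv]]|H] := pselect (exists v, v != 0 /\ bil g v v < 0).
  exists true => w w0; rewrite bilZ expr1 mulN1r oppr_gt0 ltNge le_eqVlt eq_sym.
  rewrite (negPf (nz w w0)) /=; apply/negP => qw.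
  pose a := bil g v v; pose b := bil g v w; pose c := bil g w w.
  have D0 : 0 <= b ^+ 2 - a * c.
    by rewrite addr_ge0 ?sqr_ge0 // oppr_ge0 nmulr_rle0 // ltW.
  pose t := (- b + Num.sqrt (b ^+ 2 - a * c)) / a.
  have a0 : a != 0 by exact: nz.
  have qt : bil g (w + t *: v) (w + t *: v) = 0.
    rewrite bil_quad // -/a -/b -/c.
    have := sqr_sqrtr D0; rewrite /t; set r := Num.sqrt _ => rD.
    transitivity ((r ^+ 2 - (b ^+ 2 - a * c)) / a); first by field.
    by rewrite rD subrr mul0r.
  have [/eqP|u0] := eqVneq (w + t *: v) 0; last first.
    by have := nz _ u0; rewrite qt eqxx.
  rewrite addr_eq0 => /eqP wE.
  have : bil g w w <= 0.
    have -> : bil g w w = (- t) ^+ 2 * bil g v v.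
      by rewrite wE -scaleNr /bil linearZ /= -!scalemxAl -scalemxAr !mxE; ring.
    by rewrite mulr_ge0_le0 ?sqr_ge0 // ltW.
  by rewrite leNgt qw.
exists false => v v0; rewrite bilZ mul1r lt_neqAle eq_sym nz //= leNgt.
by apply/negP => qv; apply: H; exists v.
Qed.

Lemma G2_induces_ex phi : G2_structure phi -> exists g vol, G2_induces phi g vol.
Proof.
move=> [f3 nz]; pose B := G2_mx phi.
have sB : B^T = B by exact: G2_mx_sym.
have nzB v : v != 0 -> bil B v v != 0.
  move=> /nz; apply: contra_neq; rewrite G2_mxE => v0.
  have /eqP := top_formE (@G2_form_top _ v v f3); rewrite v0 scale0r.
  by rewrite scaler_eq0 invr_eq0 pnatr_eq0 => /eqP.
have [s pos] := definite_bil sB nzB.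
have D0 := det_gt0 pos; set D := \det _ in D0.
have [||x /andP[x0 _]] := @poly_ivt R ('X^9 - D%:P) 0 (1 + D).
- by rewrite addr_ge0 ?ler01 // ltW.
- rewrite !hornerE expr0n /= add0r oppr_le0 ltW //= subr_ge0.
  have D1 : 1 <= 1 + D by rewrite lerDl ltW.
  by rewrite (le_trans _ (ler_eXnr _ D1)) // lerDr ler01.
rewrite /root !hornerE subr_eq0 => /eqP xD.
have {}x0 : 0 < x.
  rewrite lt_neqAle x0 andbT; apply: contraTneq D0 => x_eq0.
  by rewrite -xD -x_eq0 expr0n ltxx.
pose c := (-1) ^+ s * x.
have s2 : (-1) ^+ s * (-1) ^+ s = 1 :> R by rewrite -expr2 sqrr_sign.
have c0 : c != 0 by rewrite mulf_neq0 ?signr_eq0 // gt_eqF.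
have BE : B = (-1) ^+ s *: ((-1) ^+ s *: B) by rewrite scalerA s2 scale1r.
have dB : \det B = c ^+ 9.
  rewrite BE detZ -/D -xD /c exprMn; congr (_ * _).
  by rewrite -!exprM -signr_odd -[RHS]signr_odd !oddM.
exists (c^-1 *: B), (c *: monomial R setT); split.
- split=> [|v v0]; first by rewrite linearZ /= sB.
  have -> : c^-1 = x^-1 * (-1) ^+ s.
    by rewrite /c invfM mulrC; congr (_ * _); rewrite invr_sign.
  by rewrite -scalerA bilZ mulr_gt0 ?invr_gt0 ?pos.
- split=> [A nA|]; rewrite ext_scaleE ffunE.
    case: eqP => [AE|_]; last by rewrite mulr0.
    by rewrite AE cardsT card_ord eqxx in nA.
  by rewrite eqxx mulr1 detZ dB; field.
move=> v w; rewrite -/(G2_form phi v w) (top_formE (G2_form_top v w f3)) -G2_mxE.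
by rewrite bilZ scalerA; congr (_ *: _); rewrite mulrAC mulVf // mul1r.
Qed.

Lemma G2_inducesP phi :
  G2_structure phi -> G2_induces phi (G2_metric phi) (G2_vol phi).
Proof.
move=> /G2_induces_ex[g [vol ind]].
apply: (@classical_sets.xgetPex _ _ (fun p => G2_induces phi p.1 p.2)).
by exists (g, vol).
Qed.

Lemma ixE k : (0 < k < 8)%N -> ix k = k.-1 :> nat.
Proof. by case: k => // k; rewrite ltnS /ix => kn; rewrite inordK. Qed.

Lemma eq_ix j k : (0 < j < 8)%N -> (0 < k < 8)%N -> (ix j == ix k) = (j == k).
Proof. by move=> hj hk; rewrite -val_eqE /= !ixE //; case: j k hj hk => [|j] [|k]. Qed.

Lemma n52R2_is_lie_bracket : is_lie_bracket (@n52R2_bracket R).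
Proof.
have E (a b : R) i : (- a *: basis_vec R (ix 5) - b *: basis_vec R (ix 6)) 0 i
    = - a * (i == ix 5)%:R - b * (i == ix 6)%:R by rewrite !mxE.
split=> [t u v w|t u v w|v|u v w]; apply/rowP => i; rewrite ?mxE /n52R2_bracket ?E ?mxE.
- ring.
- ring.
- ring.
- by rewrite !eq_ix //=; ring.
Qed.

Lemma n52R2_tuple :
  [seq CE_diff (@n52R2_bracket R) (covec R (ix k)) | k <- iota 1 7] =
  [:: 0; 0; 0; 0; wedge (covec R (ix 1)) (covec R (ix 2));
      wedge (covec R (ix 1)) (covec R (ix 3)); 0].
Proof.
have E (a b : R) i : (- a *: basis_vec R (ix 5) - b *: basis_vec R (ix 6)) 0 i
    = - a * (i == ix 5)%:R - b * (i == ix 6)%:R by rewrite !mxE.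
rewrite /= !CE_diff_covec.
have d0 k : (0 < k < 8)%N -> k != 5%N -> k != 6%N -> d_covec (@n52R2_bracket R) (ix k) = 0.
  move=> hk k5 k6; rewrite /d_covec big1 // => i _; rewrite big1 // => j _.
  by rewrite E !eq_ix // (negPf k5) (negPf k6) !mulr0 subrr oppr0 scale0r.
have dE (m k : nat) : (1 < k < 8)%N ->
    (forall x y : V, n52R2_bracket x y 0 (ix m) =
       - (x 0 (ix 1) * y 0 (ix k) - x 0 (ix k) * y 0 (ix 1))) ->
    d_covec (@n52R2_bracket R) (ix m) = wedge (covec R (ix 1)) (covec R (ix k)).
  move=> hk brE; have ik : ix k = k.-1 :> nat by rewrite ixE //; case: k hk {brE} => [|[]].
  have i1 : ix 1 = 0%N :> nat by rewrite ixE.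
  have k1 : (0 < k.-1)%N by case: k hk {brE ik} => [|[]].
  rewrite /d_covec (bigD1 (ix 1)) //= (bigD1 (ix k)) ?i1 ?ik //=.
  rewrite brE !mxE !eqxx -[ix k == ix 1]val_eqE /= i1 ik (gtn_eqF k1).
  rewrite -[ix 1 == ix k]val_eqE /= i1 ik (ltn_eqF k1).
  rewrite big1 => [|j /andP[_ jk]]; last first.
    rewrite brE !mxE !eqxx /= (negPf (_ : ix k != j)) ?(eq_sym _ j) //.
    rewrite -[ix k == ix 1]val_eqE /= i1 ik (gtn_eqF k1).
    by rewrite !(mulr0, mul0r) subrr !oppr0 scale0r.
  rewrite big1 => [|i ni]; last first.
    rewrite big1 // => j ij; rewrite brE !mxE !eqxx /= ![ix _ == _]eq_sym (negPf ni) mul0r.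
    have -> : (j == ix 1) = false.
      by apply/negbTE; rewrite -val_eqE /= i1 -lt0n (leq_ltn_trans _ ij).
    by rewrite mulr0 subrr !oppr0 scale0r.
  by rewrite !addr0 !(mulr0, mulr1) subr0 opprK scale1r.
rewrite (d0 1%N) // (d0 2%N) // (d0 3%N) // (d0 4%N) // (d0 7%N) // (dE 5%N 2%N) // => [|x y]; last by rewrite E !eq_ix //=; ring.
by rewrite (dE 6%N 3%N) // => x y; rewrite E !eq_ix //=; ring.
Qed.

Lemma n52R2_metricE (E G : R) : n52R2_metric E G =
  diag_mx (\row_i (if i == ix 5 then E else if i == ix 6 then G else 1)).
Proof.
have sq i : symprod R i i = delta_mx i i.
  by rewrite /symprod /tensor -mulr2n -scaler_nat scalerA mulVf ?scale1r // pnatr_eq0.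
rewrite /n52R2_metric big_nat_recr //= big_nat_recr //= big_nat_recr //= big_nat1 !sq.
have all_ix (P : 'I_7 -> Prop) :
    P (ix 1) -> P (ix 2) -> P (ix 3) -> P (ix 4) -> P (ix 5) -> P (ix 6) -> P (ix 7) ->
    forall i, P i.
  move=> p1 p2 p3 p4 p5 p6 p7 i; rewrite -[i]inord_val -[nat_of_ord i]/(i.+1.-1).
  by case: i => -[|[|[|[|[|[|[|]]]]]]].
by apply/matrixP => i j; rewrite !mxE; elim/all_ix: i; elim/all_ix: j;
  rewrite !eq_ix //= ?mulr0n ?mulr1n; ring.
Qed.

End G2Theory.

(* Main.v *)
Require Import Defs.
From mathcomp Require Import all_boot all_order all_algebra reals.
From mathcomp Require Import ring lra.
Import Order.TTheory GRing.Theory Num.Theory.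
Local Open Scope ring_scope.

(** Write [phi = f^1 /\ omega + rho] with [omega] and [rho] forms on the span W
of f_2, ..., f_7. Since [d a = f^12 /\ (f_5 _| a) + f^13 /\ (f_6 _| a)],
coclosedness is linear in [omega]: the covectors [omega(f_2, .)] and
[omega(f_3, .)] are combinations of f^5 and f^6, and
[E omega_26 = G omega_35]. From the definition of the metric one gets
[omega /\ rho = 0], and then that Hitchin's endomorphism K of rho, given by
[(w _| rho) /\ rho = K w _| vol], is a multiple of the inverse of [omega] with
respect to g. As [omega] is sparse, the entries of K on f_2, f_3, f_5, f_6 are
explicit. Pureness says [K_52 + K_63 = 0], that is [E omega_36 + G omega_25 = 0],
and Hitchin's identity that K^2 is a scalar, compared on f_5 and f_6, gives
[E (omega_36^2 + omega_26^2) = G (omega_25^2 + omega_35^2)]. The three relations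
together force [G = E]. *)

(** * Computing with exterior forms *)

Section SparseForms.
Set Implicit Arguments.
Unset Strict Implicit.
Unset Printing Implicit Defensive.
Variables (R : realType) (n : nat).
Local Notation V := 'rV[R]_n.
Local Notation L := (ext R n).
Implicit Types (s t : bitseq) (l m : seq (R * bitseq)) (i j : 'I_n).

(* Subsets of 'I_n are encoded by bit sequences of length n, and forms by lists of
   coefficients and subsets, so that products and contractions can be expanded by
   reduction into polynomials in the coefficients. *)
Definition mset s : {set 'I_n} := [set i : 'I_n | nth false s i].

Fixpoint mpar s : bool := if s is b :: s' then b (+) mpar s' else false.

(** The parity of [inversions]: position 0 of [t] is passed by every later element of [s], while
    position 0 of [s] passes nothing. *)
Fixpoint msign s t : bool :=
  match s, t with
  | b :: s', c :: t' => (c && mpar s') (+) msign s' t'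
  | _, _ => false
  end.

Fixpoint mdisj s t : bool :=
  match s, t with
  | b :: s', c :: t' => if b && c then false else mdisj s' t'
  | _, _ => true
  end.

Fixpoint munion s t : bitseq :=
  match s, t with
  | b :: s', c :: t' => (b || c) :: munion s' t'
  | _, _ => [::]
  end.

Fixpoint meq s t : bool :=
  match s, t with
  | [::], [::] => true
  | b :: s', c :: t' => if b (+) c then false else meq s' t'
  | _, _ => false
  end.

Fixpoint msingle (k n : nat) : bitseq :=
  match n, k with
  | n'.+1, k'.+1 => false :: msingle k' n'
  | n'.+1, 0 => true :: nseq n' false
  | 0, _ => [::]
  end.

Fixpoint masks (n k : nat) : seq bitseq :=
  if n is n'.+1 then
    (if k is k'.+1 then map (cons true) (masks n' k') else [::])
      ++ map (cons false) (masks n' k)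
  else if k is 0 then [:: [::]] else [::].

Definition leval l : L := \sum_(x <- l) x.1 *: monomial R (mset x.2).

Fixpoint lwedge1 (c : R) s m : seq (R * bitseq) :=
  if m is x :: m' then
    if mdisj s x.2 then
      ((if msign s x.2 then - (c * x.1) else c * x.1), munion s x.2) :: lwedge1 c s m'
    else lwedge1 c s m'
  else [::].

Fixpoint lwedge l m : seq (R * bitseq) :=
  if l is x :: l' then lwedge1 x.1 x.2 m ++ lwedge l' m else [::].

Fixpoint mremove (k : nat) s : bitseq :=
  match s, k with
  | b :: s', k'.+1 => b :: mremove k' s'
  | b :: s', 0 => false :: s'
  | [::], _ => [::]
  end.

Fixpoint lint (k : nat) l : seq (R * bitseq) :=
  if l is x :: l' then
    if nth false x.2 k then
      ((if mpar (take k x.2) then - x.1 else x.1), mremove k x.2) :: lint k l'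
    else lint k l'
  else [::].

(** Products may list the same subset several times, so all matching coefficients are added. *)
Fixpoint lcoef s l : R :=
  if l is x :: l' then (if meq s x.2 then x.1 + lcoef s l' else lcoef s l') else 0.

(** Missing bits read as false and bits beyond n are ignored by [mset], so only at length n is the
    encoding of subsets injective. *)
Definition wf l := all (fun x => size x.2 == n) l.

Lemma msign_odd k s t : size s = k -> size t = k ->
  odd (\sum_(i < k) \sum_(j < k) [&& nth false s i, nth false t j & (j < i)%N])
    = msign s t.
Proof.
elim: k s t => [|k IHk] [|b s] [|c t] //=; first by rewrite big_ord0.
move=> [ss] [st]; rewrite big_ord_recl /= big1 ?add0n => [|i _]; last by rewrite !andbF.
under eq_bigr => i _ do rewrite big_ord_recl /=.
rewrite big_split oddD /= IHk //; congr (_ (+) _).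
rewrite -{IHk}ss {st t}; elim: s => [|a s IHs] /=; first by rewrite big_ord0 andbF.
by rewrite big_ord_recl oddD IHs /= andbT andb_addr andbC; case: (c && a).
Qed.

Lemma signr_msign s t : size s = n -> size t = n ->
  (-1) ^+ inversions (mset s) (mset t) = (if msign s t then -1 else 1) :> R.
Proof.
move=> ss st; rewrite -signr_odd -(msign_odd ss st) /inversions big_mkcond /=.
set a := (\sum_i _)%N; set b := (\sum_i _)%N; have -> : a = b.
  apply: eq_bigr => i _; rewrite inE; case: (nth false s i); last by rewrite big1.
  by rewrite big_mkcond; apply: eq_bigr => j _; rewrite inE; case: ifP.
by case: (odd b).
Qed.

Lemma nth_munion s t k : size s = size t ->
  nth false (munion s t) k = nth false s k || nth false t k.
Proof. by elim: s t k => [|b s IHs] [|c t] [|k] //= [/IHs]. Qed.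

Lemma size_munion s t : size s = size t -> size (munion s t) = size s.
Proof. by elim: s t => [|b s IHs] [|c t] //= [/IHs->]. Qed.

Lemma msetU s t : size s = size t -> mset (munion s t) = mset s :|: mset t.
Proof. by move=> st; apply/setP => i; rewrite !inE nth_munion. Qed.

Lemma mdisjP s t k : mdisj s t -> nth false s k -> nth false t k -> False.
Proof.
elim: s t k => [|b s IHs] [|c t] [|k] //=; rewrite ?nth_nil //.
  by case: b c => [] [].
by case: b c => [] [] //=; apply: IHs.
Qed.

Lemma mdisjPn s t : ~~ mdisj s t -> exists k, [/\ nth false s k, nth false t k & (k < size s)%N].
Proof.
elim: s t => [|b s IHs] [|c t] //=; case: ifP => [/andP[-> ->] _|_ /IHs[k]].
  by exists 0%N.
by exists k.+1.
Qed.

Lemma mset_disjoint s t : size s = n -> [disjoint mset s & mset t] = mdisj s t.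
Proof.
move=> ss; have [d|/mdisjPn[k [sk tk kn]]] := boolP (mdisj s t).
  apply/pred0P => i /=; rewrite !inE; apply/negP => /andP[]; exact: (mdisjP d).
rewrite ss in kn; apply/negP => /pred0P /(_ (Ordinal kn)) /=.
by rewrite !inE /= sk tk.
Qed.

Lemma meqP s t : reflect (s = t) (meq s t).
Proof.
apply: (iffP idP) => [|<-]; last by elim: s => //= b s ->; rewrite addbb.
by elim: s t => [|b s IHs] [|c t] //=; case: b c => [] [] //= /IHs ->.
Qed.

Lemma mset_inj s t : size s = n -> size t = n -> (mset s == mset t) = meq s t.
Proof.
move=> ss st; apply/eqP/meqP => [E|-> //].
apply: (@eq_from_nth _ false) => [|k]; rewrite ss // => kn.
by move/setP/(_ (Ordinal kn)): E; rewrite !inE.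
Qed.

Lemma wedge_monomial (B C : {set 'I_n}) : wedge (monomial R B) (monomial R C) =
  if [disjoint B & C] then (-1) ^+ inversions B C *: monomial R (B :|: C) else 0.
Proof.
apply/ffunP => A; rewrite ffunE; have [sBA|nsBA] := boolP (B \subset A); last first.
  rewrite big1 => [|D sDA]; last first.
    have /negPf nDB : D != B by apply: contraNneq nsBA => <-.
    by rewrite ffunE nDB mulr0 mul0r.
  case: ifP => _; rewrite !ffunE //; case: eqP => [AE|_]; last by rewrite scaler0.
  by rewrite AE subsetUl in nsBA.
rewrite (bigD1 B) //= big1 ?addr0 => [|D /andP[_ /negPf nDB]]; last first.
  by rewrite ffunE nDB mulr0 mul0r.
rewrite !ffunE eqxx mulr1; case: eqP => [<-|nC].
  rewrite -setI_eq0 setIDA setDIl setDv set0I eqxx ext_scaleE ffunE.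
  by rewrite -{5}(setIidPr sBA) setID eqxx mulr1.
rewrite mulr0; case: ifP => [dBC|_]; rewrite !ffunE //.
case: eqP => [AE|_]; last by rewrite scaler0.
by case: nC; rewrite AE setDUl setDv set0U; apply/setDidPl; rewrite disjoint_sym.
Qed.

Lemma leval_cons x l : leval (x :: l) = x.1 *: monomial R (mset x.2) + leval l.
Proof. exact: big_cons. Qed.

Lemma leval_cat l m : leval (l ++ m) = leval l + leval m.
Proof. exact: big_cat. Qed.

Lemma leval_nil : leval [::] = 0.
Proof. exact: big_nil. Qed.

Lemma wedgeL1 c s m : size s = n -> wf m ->
  wedge (c *: monomial R (mset s)) (leval m) = leval (lwedge1 c s m).
Proof.
move=> ss; elim: m => [_|[d t] m IHm /= /andP[/eqP st wfm]]; first by rewrite /= leval_nil wedge0.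
rewrite leval_cons /= wedgeDr wedgeZl wedgeZr wedge_monomial mset_disjoint //= IHm //.
case: ifP => _; last by rewrite !scaler0 add0r.
rewrite leval_cons /= msetU ?ss //; congr (_ + _).
by rewrite signr_msign // !scalerA; case: ifP => _; rewrite ?mulrN1 ?mulr1.
Qed.

Lemma wedgeL l m : wf l -> wf m -> wedge (leval l) (leval m) = leval (lwedge l m).
Proof.
elim: l => [|[c s] l IHl] /=; first by rewrite leval_nil wedge0l.
move=> /andP[/eqP ss wfl] wfm; rewrite leval_cons leval_cat wedgeDl IHl //=.
by rewrite wedgeL1.
Qed.

Lemma interior_monomial i (A : {set 'I_n}) : interior (basis_vec R i) (monomial R A) =
  if i \in A then (-1) ^+ inversions [set i] (A :\ i) *: monomial R (A :\ i) else 0.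
Proof.
apply/ffunP => B; rewrite interior_basis; case: (boolP (i \in A)) => iA; rewrite ?ext_scaleE !ffunE.
  case: ifP => iB.
    by case: eqP iB => [->|]; rewrite ?inE ?eqxx // mulr0.
  have [->|nB] := eqVneq B (A :\ i); first by rewrite setD1K // eqxx.
  rewrite !mulr0; case: eqP => [AE|_]; last by rewrite mulr0.
  by rewrite -AE setU1K ?eqxx ?iB in nB.
case: ifP => // _; case: eqP => [AE|_]; last by rewrite mulr0.
by rewrite -AE setU11 in iA.
Qed.

Lemma nth_mremove k s (j : nat) : nth false (mremove k s) j = (j != k) && nth false s j.
Proof.
by elim: s k j => [|b s IHs] [|k] [|j] //=; rewrite ?andbF // eqSS IHs.
Qed.

Lemma size_mremove k s : size (mremove k s) = size s.
Proof. by elim: s k => [|b s IHs] [|k] //=; rewrite IHs. Qed.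

Lemma mpar_take s k : size s = n -> (k < n)%N ->
  odd (\sum_(j < n) (nth false s j && (j < k))%N) = mpar (take k s).
Proof.
move=> <-; elim: s k => [|b s IHs] [|k] //=; rewrite big_ord_recl /=.
  by rewrite big1 ?andbF // => i _; rewrite andbF.
by rewrite oddD ltnS => /IHs ->; rewrite andbT; case: b.
Qed.

(** Contraction moves f^i to the front, past the elements of the subset below i; [mpar (take i s)]
    is the parity of their number. *)
Lemma interiorL i l : wf l -> interior (basis_vec R i) (leval l) = leval (lint i l).
Proof.
elim: l => [_|[c s] l IHl /= /andP[/eqP ss wfl]]; first by rewrite leval_nil linear0.
rewrite leval_cons linearD linearZ /= interior_monomial IHl // inE /=.
case: ifP => si; last by rewrite scaler0 add0r.
rewrite leval_cons /=; congr (_ + _); rewrite scalerA.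
have -> : mset s :\ i = mset (mremove i s).
  by apply/setP => j; rewrite !inE nth_mremove.
congr (_ *: _); rewrite /inversions big_set1 -signr_odd big_mkcond /=.
rewrite -mpar_take //.
set a := (\sum_j _)%N; set b := (\sum_j _)%N; have -> : a = b.
  apply: eq_bigr => j _; rewrite inE nth_mremove.
  by have [->|] := eqVneq (j : nat) i; rewrite ?ltnn ?andbF //=; case: (nth _ _ _).
by case: (odd b); rewrite ?mulrN1 ?mulr1.
Qed.

Lemma lcoefE s l : size s = n -> wf l -> leval l (mset s) = lcoef s l.
Proof.
move=> ss; elim: l => [_|[c t] l IHl /= /andP[/eqP st wfl]]; first by rewrite leval_nil ffunE.
rewrite leval_cons ext_addE ext_scaleE ffunE mset_inj //= IHl //.
by case: ifP; rewrite ?mulr1 // mulr0 add0r.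
Qed.

Lemma wf_lwedge l m : wf l -> wf m -> wf (lwedge l m).
Proof.
move=> wfl wfm; elim: l wfl => [|[c s] l IHl] //= /andP[/eqP ss /IHl].
rewrite /wf all_cat => ->; rewrite andbT {IHl}.
elim: m wfm => [|[d t] m IHm] //= /andP[/eqP st /IHm wfm]; case: ifP => //= _.
by rewrite size_munion ss ?eqxx.
Qed.

Lemma wf_lint k l : wf l -> wf (lint k l).
Proof.
elim: l => [|[c s] l IHl] //= /andP[ss /IHl wfl]; case: ifP => //= _.
by rewrite size_mremove ss.
Qed.

(** * Expansion of a k-form in monomials *)

Definition mask (A : {set 'I_n}) : bitseq := [seq i \in A | i <- enum 'I_n].

Lemma size_mask A : size (mask A) = n.
Proof. by rewrite size_map size_enum_ord. Qed.

Lemma maskK A : mset (mask A) = A.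
Proof.
apply/setP => i; rewrite inE (nth_map i) ?nth_ord_enum //.
by rewrite size_enum_ord.
Qed.

Lemma leval_eq0 l : wf l ->
  leval l = 0 <-> forall s, size s = n -> lcoef s l = 0.
Proof.
move=> wfl; split=> [l0 s sn|l0]; first by rewrite -lcoefE // l0 ffunE.
apply/ffunP => A; have [s sn <-] : exists2 s, size s = n & mset s = A.
  by exists (mask A); rewrite ?size_mask ?maskK.
by rewrite lcoefE // l0 // ffunE.
Qed.

Lemma mem_map_cons (b c : bool) s (S : seq bitseq) :
  (b :: s \in map (cons c) S) = (b == c) && (s \in S).
Proof.
apply/mapP/andP => [[t tS [-> ->]]|[/eqP-> sS]]; first by rewrite eqxx.
by exists s.
Qed.

Lemma nil_map_cons (c : bool) (S : seq bitseq) : ([::] \in map (cons c) S) = false.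
Proof. by apply/negP => /mapP[]. Qed.

Lemma mem_masks s k (m : nat) : (s \in masks m k) = (size s == m) && (count id s == k).
Proof.
elim: m k s => [|m IHm] [|k] [|b s] //=; rewrite ?mem_cat ?nil_map_cons //.
  by rewrite mem_map_cons IHm; case: b; rewrite ?andbF.
by rewrite !mem_map_cons !IHm; case: b; rewrite ?orbF ?add1n ?add0n ?eqSS.
Qed.

Lemma masks_uniq k (m : nat) : uniq (masks m k).
Proof.
have consI (c : bool) : injective (cons c) by move=> ? ? [].
elim: m k => [|m IHm] [|k] //=; rewrite ?cat_uniq !map_inj_uniq ?IHm //= andbT.
by apply/hasPn => _ /mapP[t _ ->]; rewrite /= mem_map_cons.
Qed.

Lemma card_mset s : size s = n -> #|mset s| = count id s.
Proof.
move=> ss; rewrite cardsE -sum1_card big_mkcond /= -sum1_count [RHS]big_mkcond.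
by rewrite (big_nth false) ss big_mkord; apply: eq_bigr => i _; rewrite unfold_in.
Qed.

Definition expand k (c : bitseq -> R) := [seq (c s, s) | s <- masks n k].

Lemma wf_expand k c : wf (expand k c).
Proof.
by rewrite /wf all_map; apply/allP => s /=; rewrite mem_masks => /andP[].
Qed.

(** Makes an arbitrary form a list with generic coefficients: once these are abstracted, an identity
    between forms becomes a polynomial identity. *)
Lemma expandE k a : is_form k a -> a = leval (expand k (fun s => a (mset s))).
Proof.
move=> fa; rewrite /leval /expand big_map /= [LHS]ext_monomialE.
rewrite (bigID (fun A : {set 'I_n} => #|A| == k)) /= [X in _ + X]big1 ?addr0; last first.
  by move=> A nA; rewrite fa // scale0r.
rewrite -(big_map mset xpredT (fun A => a A *: monomial R A)) -big_filter.
apply: perm_big; apply: uniq_perm.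
- by rewrite filter_uniq // index_enum_uniq.
- rewrite map_inj_in_uniq ?masks_uniq // => s t.
  rewrite !mem_masks => /andP[/eqP ss _] /andP[/eqP st _] /eqP.
  by rewrite mset_inj // => /meqP.
move=> A; rewrite mem_filter mem_index_enum andbT; apply/eqP/mapP => [cA|[s]].
  exists (mask A); last by rewrite maskK.
  by rewrite mem_masks size_mask -card_mset ?size_mask // maskK cA !eqxx.
by rewrite mem_masks => /andP[/eqP ss /eqP <-] ->; rewrite card_mset.
Qed.

(** * The Hodge operator of a diagonal metric *)

Lemma msetC s : size s = n -> mset (map negb s) = ~: mset s.
Proof. by move=> ss; apply/setP => i; rewrite !inE (nth_map false) ?ss. Qed.

Fixpoint mprod (d : seq R) s : R :=
  match d, s with
  | x :: d', b :: s' => (if b then x else 1) * mprod d' s'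
  | _, _ => 1
  end.

Lemma mprodE d s : size d = n -> size s = n ->
  \prod_(i in mset s) nth 0 d i = mprod d s.
Proof.
move=> dn sn; rewrite big_mkcond /=.
under eq_bigr => i _ do rewrite inE.
rewrite -(big_mkord xpredT (fun k => if nth false s k then nth 0 d k else 1)).
rewrite -dn in sn *; elim: d s sn {dn} => [|x d IHd] [|b s] //= => [_|[/IHd <-]].
  by rewrite big_geq.
by rewrite big_nat_recl.
Qed.

Lemma interiorZl (t : R) (v : V) (a : L) : interior (t *: v) a = t *: interior v a.
Proof.
apply/ffunP => A; rewrite ext_scaleE !ffunE mulr_sumr; apply: eq_bigr => i _.
by rewrite mxE; ring.
Qed.

Lemma eval_formZ (t : R) (a : L) (vs : seq V) : eval_form (t *: a) vs = t * eval_form a vs.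
Proof.
elim: vs a => [|v vs IHvs] a; first by rewrite /eval_form /= ext_scaleE.
by rewrite /eval_form /= interiorZ; apply: IHvs.
Qed.

(** Contracting in increasing order creates no sign: each index removed is smaller than all those
    that remain. *)
Lemma eval_form_basis (a : L) (r : seq 'I_n) : sorted ltn (map val r) ->
  eval_form a [seq basis_vec R i | i <- r] = a [set i in r].
Proof.
elim: r a => [|i r IHr] a /=; first by rewrite set_nil.
move=> ir; rewrite -[LHS]/(eval_form (interior (basis_vec R i) a) _).
rewrite IHr ?(path_sorted ir) // interior_basis inE.
have ltr j : j \in r -> (i < j)%N.
  by move=> jr; apply: (allP (order_path_min ltn_trans ir)); apply: map_f.
have -> : (i \in r) = false by apply/negP => /ltr; rewrite ltnn.
rewrite set_cons /inversions big_set1 big1 ?mul1r // => j.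
by rewrite inE => /ltr; case: ltngtP.
Qed.

Lemma sharp_diag (d : 'rV[R]_n) i : (forall j, d 0 j != 0) ->
  sharp (diag_mx d) i = (d 0 i)^-1 *: basis_vec R i.
Proof.
move=> d0; pose e : 'rV[R]_n := \row_j (d 0 j)^-1.
have de : diag_mx d *m diag_mx e = 1%:M.
  rewrite mulmx_diag -diag_const_mx; congr diag_mx.
  by apply/rowP => j; rewrite !mxE mulfV.
have -> : sharp (diag_mx d) i = row i (diag_mx e).
  have [ud _] := mulmx1_unit de.
  by rewrite /sharp -[diag_mx e]mul1mx -(mulVmx ud) -mulmxA de mulmx1.
by apply/rowP => j; rewrite !mxE eqxx /= eq_sym; case: eqP; rewrite ?mulr1 ?mulr0.
Qed.

(** For a diagonal metric [sharp] only rescales basis vectors, so the pairing with a monomial picks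
    out one coefficient, divided by the metric entries of its indices. *)
Lemma hodge_diag (d : 'rV[R]_n) (vol b : L) (A : {set 'I_n}) : (forall j, d 0 j != 0) ->
  hodge (diag_mx d) vol b A = (-1) ^+ inversions (~: A) A *
    ((\prod_(i in ~: A) (d 0 i)^-1) * b (~: A)) * vol setT.
Proof.
move=> d0; rewrite ffunE form_ip_monomial; congr (_ * _ * _).
move: (~: A) => {}A; under eq_map => i do rewrite sharp_diag //.
transitivity ((\prod_(i <- enum A) (d 0 i)^-1) *
    eval_form b [seq basis_vec R i | i <- enum A]).
  elim: (enum A) b => [|i r IHr] b; first by rewrite big_nil mul1r.
  rewrite big_cons /= -[LHS]/(eval_form (interior _ b) _) interiorZl eval_formZ IHr.
  by rewrite mulrA.
rewrite big_enum eval_form_basis; first by rewrite set_enum.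
apply: (subseq_sorted ltn_trans (s2 := map val (enum 'I_n))).
  by rewrite enumT; apply/map_subseq/filter_subseq.
by rewrite val_enum_ord iota_ltn_sorted.
Qed.

Lemma hodge_form k (d : 'rV[R]_n) (vol b : L) : (forall j, d 0 j != 0) ->
  is_form k b -> is_form (n - k) (hodge (diag_mx d) vol b).
Proof.
move=> d0 fb A nA; rewrite hodge_diag // fb ?mulr0 ?mul0r //.
by apply: contra_neq nA => <-; rewrite -[X in (X - _)%N]card_ord -(cardsC A) addnK.
Qed.

Lemma hodge_diag_mset (d : seq R) (vol b : L) s :
  size d = n -> size s = n -> all (fun x => x != 0) d ->
  hodge (diag_mx (\row_i nth 0 d i)) vol b (mset s) =
    (if msign (map negb s) s then -1 else 1) *
      (mprod (map GRing.inv d) (map negb s) * b (mset (map negb s))) * vol setT.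
Proof.
move=> dn sn d0; rewrite hodge_diag => [|j]; last first.
  by rewrite mxE (all_nthP 0 d0) // dn.
rewrite -msetC // signr_msign ?size_map //; congr (_ * (_ * _) * _).
rewrite -mprodE ?size_map //; apply: eq_bigr => i _.
by rewrite mxE (nth_map 0) ?dn.
Qed.

Lemma eq_expand k (c c' : bitseq -> R) :
  (forall s, size s = n -> c s = c' s) -> expand k c = expand k c'.
Proof.
move=> cc; apply/eq_in_map => s; rewrite mem_masks => /andP[/eqP sn _].
by rewrite cc.
Qed.

Lemma leval_form k l : all (fun x => (size x.2 == n) && (count id x.2 == k)) l ->
  is_form k (leval l).
Proof.
move=> lk A nA; rewrite /leval ext_sumE big1_seq // => x /= xl.
have /andP[/eqP sx /eqP cx] := allP lk x xl.
rewrite ext_scaleE ffunE; case: eqP => [AE|_]; last by rewrite mulr0.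
by rewrite AE card_mset // cx eqxx in nA.
Qed.

Lemma hodge_expand k (d : seq R) (vol b : L) (c : bitseq -> R) :
  size d = n -> all (fun x => x != 0) d -> is_form k b ->
  (forall s, size s = n -> b (mset s) = c s) ->
  hodge (diag_mx (\row_i nth 0 d i)) vol b = leval (expand (n - k) (fun s =>
    (if msign (map negb s) s then -1 else 1) *
      (mprod (map GRing.inv d) (map negb s) * c (map negb s)) * vol setT)).
Proof.
move=> dn d0 fb bc; rewrite [LHS](expandE (hodge_form _ _ fb)) => [|j]; last first.
  by rewrite mxE (all_nthP 0 d0) // dn.
congr leval; apply: eq_expand => s sn.
by rewrite hodge_diag_mset // bc // size_map.
Qed.

Lemma msetT : mset (nseq n true) = setT.
Proof. by apply/setP => i; rewrite !inE nth_nseq ltn_ord. Qed.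

Lemma mset0 : mset (nseq n false) = set0.
Proof. by apply/setP => i; rewrite !inE nth_nseq if_same. Qed.

Lemma covecL i : covec R i = leval [:: (1, msingle i n)].
Proof.
rewrite leval_cons leval_nil addr0 scale1r; congr (monomial R _).
apply/setP => j; rewrite !inE -val_eqE /=.
elim: (n) (i : nat) (j : nat) (ltn_ord i) => [|m IHm] [|k] [|p] //=.
- by rewrite nth_nseq if_same.
- by rewrite eqSS; apply: IHm.
Qed.

Lemma size_msingle k (m : nat) : size (msingle k m) = m.
Proof. by elim: m k => [|m IHm] [|k] //=; rewrite ?size_nseq ?IHm. Qed.

End SparseForms.

(** * G2-structures on R^7 *)

Section Seven.
Set Implicit Arguments.
Unset Strict Implicit.
Unset Printing Implicit Defensive.
Variable R : realType.
Implicit Types (phi : ext R 7) (l : seq (R * bitseq)).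

Local Notation e_ k := (basis_vec R (ix k)).

(** For i = 1 these are the components omega_jk. *)
Definition coef3 phi i j k : R := eval_form phi [:: e_ i; e_ j; e_ k].

(* For 1 < i, j this is the (i, j) entry of Hitchin's endomorphism of the part
   [rho] of [phi] without f^1; for i = 1 it is a coefficient of [omega /\ rho]. *)
Definition hitchin phi i j : R :=
  wedge (wedge (wedge (covec R (ix 1)) (interior (e_ i) phi)) phi)
    (covec R (ix j)) setT.

Lemma interior_ixL k l : (0 < k < 8)%N -> wf 7 l ->
  interior (e_ k) (leval 7 l) = leval 7 (lint k.-1 l).
Proof. by move=> hk wfl; rewrite interiorL // ixE. Qed.

Lemma covec_ixL k : (0 < k < 8)%N ->
  covec R (ix k) = leval 7 [:: (1, msingle k.-1 7)].
Proof. by move=> hk; rewrite covecL ixE. Qed.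

Lemma wf_msingle (c : R) k : wf 7 [:: (c, msingle k 7)].
Proof. by rewrite /wf /= size_msingle. Qed.

Lemma lcoefT l : wf 7 l -> leval 7 l setT = lcoef (nseq 7 true) l.
Proof. by move=> wfl; rewrite -msetT lcoefE ?size_nseq. Qed.

Lemma coef3L l i j k : wf 7 l -> (0 < i < 8)%N -> (0 < j < 8)%N -> (0 < k < 8)%N ->
  coef3 (leval 7 l) i j k =
  lcoef (nseq 7 false) (lint k.-1 (lint j.-1 (lint i.-1 l))).
Proof.
move=> wfl hi hj hk; rewrite /coef3 /eval_form /= !interior_ixL ?wf_lint //.
by rewrite -mset0 lcoefE ?wf_lint ?size_nseq.
Qed.

Lemma hitchinL l i j : wf 7 l -> (0 < i < 8)%N -> (0 < j < 8)%N ->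
  hitchin (leval 7 l) i j = lcoef (nseq 7 true)
    (lwedge (lwedge (lwedge [:: (1, msingle 0 7)] (lint i.-1 l)) l)
      [:: (1, msingle j.-1 7)]).
Proof.
move=> wfl hi hj; have wfi := wf_lint i.-1 wfl.
rewrite /hitchin !covec_ixL // interior_ixL // !wedgeL ?lcoefT //;
  by rewrite ?wf_lwedge ?wf_msingle.
Qed.

Lemma G2_mxL l i j : wf 7 l -> (0 < i < 8)%N -> (0 < j < 8)%N ->
  G2_mx (leval 7 l) (ix i) (ix j) =
  6^-1 * lcoef (nseq 7 true) (lwedge (lwedge (lint i.-1 l) (lint j.-1 l)) l).
Proof.
move=> wfl hi hj; have wfi := wf_lint i.-1 wfl; have wfj := wf_lint j.-1 wfl.
by rewrite mxE /G2_form ext_scaleE !interior_ixL // !wedgeL ?lcoefT ?wf_lwedge.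
Qed.

Lemma cases_ix (P : nat -> Prop) :
  P 2%N -> P 3%N -> P 4%N -> P 5%N -> P 6%N -> P 7%N -> forall i, (1 < i < 8)%N -> P i.
Proof. by move=> ? ? ? ? ? ?; case=> [|[|[|[|[|[|[|[|]]]]]]]]. Qed.

Ltac generic_coefficients f3 :=
  move: (expandE f3); move: (fun s : bitseq => _) => c ->.

(* The arithmetic operations must stay folded for ring and field. *)
Ltac compute_forms :=
  cbv [expand masks map cat lwedge lwedge1 lint lcoef mdisj msign munion mprod
    mremove msingle mpar meq nth take nseq fst snd andb orb addb negb predn
    ncons iter subn subn_rec Nat.sub].

(* Hitchin's identity: the square of the endomorphism is a multiple of the
   identity, read off the diagonal entries 5 and 6. *)
Lemma hitchin_square phi : is_form 3 phi ->
  \sum_(2 <= j < 8) hitchin phi 5 j * hitchin phi j 5 =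
  \sum_(2 <= j < 8) hitchin phi 6 j * hitchin phi j 6.
Proof.
move=> f3; generic_coefficients f3; rewrite unlock /= !hitchinL ?wf_expand //.
compute_forms; ring.
Qed.

(** The 7-form omega /\ omega /\ rho vanishes on the 6-dimensional W. Contracting it with f_w trades
    omega /\ omega /\ (f_w _| rho) for -2 (f_w _| omega) /\ omega /\ rho, so only the pairing of f_w
    _| omega with omega /\ rho is left. *)
Lemma G2_mx_1 phi w : is_form 3 phi -> (1 < w < 8)%N ->
  2 * G2_mx phi (ix 1) (ix w) =
  \sum_(2 <= j < 8) coef3 phi 1 w j * hitchin phi 1 j.
Proof.
move=> f3; generic_coefficients f3; move: w; apply: cases_ix;
  rewrite unlock /= !hitchinL ?wf_expand // !coef3L ?wf_expand // G2_mxL ?wf_expand //;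
  by compute_forms; field.
Qed.

(** The second sum is the contribution of omega /\ rho. Once that form is zero, the identity says
    that omega times the transpose of K is twice the metric matrix, so that K is obtained by
    inverting omega. *)
Lemma G2_mx_perp phi v w : is_form 3 phi -> (1 < v < 8)%N -> (1 < w < 8)%N ->
  2 * G2_mx phi (ix v) (ix w) =
  \sum_(2 <= j < 8) coef3 phi 1 v j * hitchin phi w j
  - \sum_(2 <= j < 8) coef3 phi v w j * hitchin phi 1 j.
Proof.
move=> f3 hv hw; generic_coefficients f3.
move: w hw; apply: cases_ix; move: v hv; apply: cases_ix;
  rewrite unlock /= !hitchinL ?wf_expand // !coef3L ?wf_expand // G2_mxL ?wf_expand //;
  by compute_forms; field.
Qed.

Lemma coef3_anti phi j k : is_form 3 phi -> (1 < j < 8)%N -> (1 < k < 8)%N ->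
  coef3 phi 1 j k = - coef3 phi 1 k j.
Proof.
move=> f3 hj hk; generic_coefficients f3.
move: k hk; apply: cases_ix; move: j hj; apply: cases_ix;
  by rewrite !coef3L ?wf_expand //; compute_forms; ring.
Qed.

(** Since f_1 _| phi = omega, the left side is the top coefficient of omega^3 /\ f^1 divided by 6,
    that is the Pfaffian of omega. The right side expands it along row 2, with [pf] the 4 by 4
    Pfaffians. *)
Lemma G2_mx_11 phi : is_form 3 phi ->
  let w := coef3 phi 1 in
  let pf (i j k l : nat) := w i j * w k l - w i k * w j l + w i l * w j k in
  G2_mx phi (ix 1) (ix 1) =
    w 2%N 3%N * pf 4%N 5%N 6%N 7%N - w 2%N 4%N * pf 3%N 5%N 6%N 7%N + w 2%N 5%N * pf 3%N 4%N 6%N 7%N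
    - w 2%N 6%N * pf 3%N 4%N 5%N 7%N + w 2%N 7%N * pf 3%N 4%N 5%N 6%N.
Proof.
move=> f3 w pf; rewrite /pf /w {pf w}; generic_coefficients f3.
by rewrite !coef3L ?wf_expand // G2_mxL ?wf_expand //; compute_forms; field.
Qed.

(** * The differential of the Lie algebra, pureness and coclosedness *)

Lemma CE_diff_n52R2 (a : ext R 7) : CE_diff (@n52R2_bracket R) a =
  wedge (wedge (covec R (ix 1)) (covec R (ix 2))) (interior (e_ 5) a)
  + wedge (wedge (covec R (ix 1)) (covec R (ix 3))) (interior (e_ 6) a).
Proof.
have d i : (i < 7)%N -> d_covec (@n52R2_bracket R) (ix i.+1) = nth 0 [:: 0; 0; 0; 0;
    wedge (covec R (ix 1)) (covec R (ix 2)); wedge (covec R (ix 1)) (covec R (ix 3)); 0] i.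
  move=> i7; rewrite -CE_diff_covec -(n52R2_tuple R) (nth_map 0%N) ?size_iota //.
  by rewrite nth_iota.
have ixord (i : 'I_7) : i = ix i.+1.
  by apply/val_inj; case: i => -[|[|[|[|[|[|[|]]]]]]] //= ?; rewrite ixE.
rewrite /CE_diff.
under eq_bigr => i _ do rewrite {1 2}[i]ixord.
rewrite !big_ord_recl big_ord0 /=.
by rewrite /bump /= !add1n !d //= !wedge0l !add0r !addr0.
Qed.

Lemma CE_diffL l : wf 7 l -> CE_diff (@n52R2_bracket R) (leval 7 l) =
  leval 7 (lwedge [:: (1, [:: true; true; false; false; false; false; false])] (lint 4 l)
    ++ lwedge [:: (1, [:: true; false; true; false; false; false; false])] (lint 5 l)).
Proof.
move=> wfl; rewrite CE_diff_n52R2 !covec_ixL // !interior_ixL // leval_cat.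
rewrite -!wedgeL ?wf_msingle ?wf_lint //.
by congr (wedge _ _ + wedge _ _); rewrite wedgeL ?wf_msingle //= mulr1.
Qed.

Lemma wf_CE_diff l : wf 7 l ->
  wf 7 (lwedge [:: (1 : R, [:: true; true; false; false; false; false; false])] (lint 4 l)
    ++ lwedge [:: (1, [:: true; false; true; false; false; false; false])] (lint 5 l)).
Proof.
move=> wfl; rewrite /wf all_cat; apply/andP; split;
  by apply: wf_lwedge; rewrite ?wf_lint.
Qed.

(** In f^12 /\ (f_5 _| phi) /\ phi the factor f^2 moves to the end past a 5-form, whence the minus
    sign; likewise f^3 in the other term. *)
Lemma CE_diff_wedge_self phi : is_form 3 phi ->
  wedge (CE_diff (@n52R2_bracket R) phi) phi setT
    = - (hitchin phi 5 2 + hitchin phi 6 3).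
Proof.
move=> f3; generic_coefficients f3.
rewrite !hitchinL ?wf_expand // CE_diffL ?wf_expand // wedgeL ?wf_CE_diff ?wf_expand //.
rewrite lcoefT ?wf_lwedge ?wf_CE_diff ?wf_expand //.
by compute_forms; ring.
Qed.

Lemma n52R2_metric_diag (E G : R) : n52R2_metric E G =
  diag_mx (\row_i nth 0 [:: 1; 1; 1; 1; E; G; 1] i).
Proof.
rewrite n52R2_metricE; congr diag_mx; apply/rowP => i; rewrite !mxE -!val_eqE /= !ixE //.
by case: i => -[|[|[|[|[|[|[|]]]]]]].
Qed.

(** Up to a nonzero factor, the coefficients of the Hodge dual are those of phi on complementary
    indices. The term in f^12 sees only omega_2x with x different from 5, the term in f^13 only
    omega_3x with x different from 6. They meet only on f^12347, where omega_26 / G and omega_35 / E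
    are compared. *)
Lemma coclosedP (E G : R) (vol phi : ext R 7) : E != 0 -> G != 0 ->
  vol setT != 0 -> is_form 3 phi ->
  CE_diff (@n52R2_bracket R) (hodge (n52R2_metric E G) vol phi) = 0 <->
  [/\ coef3 phi 1 2 3 = 0, coef3 phi 1 2 4 = 0, coef3 phi 1 2 7 = 0 &
   [/\ coef3 phi 1 3 4 = 0, coef3 phi 1 3 7 = 0 & E * coef3 phi 1 2 6 = G * coef3 phi 1 3 5]].
Proof.
move=> E0 G0 v0 f3.
have [c cE] : exists c, (fun s => phi (mset 7 s)) = c by exists (fun s => phi (mset 7 s)).
have phiE := expandE f3; rewrite cE in phiE.
rewrite n52R2_metric_diag (@hodge_expand _ _ _ _ _ _ c _ _ f3) //; last first.
- by move=> s _; rewrite -cE.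
- by rewrite /= E0 G0 !oner_neq0.
rewrite CE_diffL ?wf_expand // leval_eq0 ?wf_CE_diff ?wf_expand // phiE.
move: (vol setT) v0 => v v0.
have -> : coef3 (leval 7 (expand 7 3 c)) 1 2 3 =
    c [:: true; true; true; false; false; false; false].
  by rewrite coef3L ?wf_expand //; compute_forms; ring.
have -> : coef3 (leval 7 (expand 7 3 c)) 1 2 4 =
    c [:: true; true; false; true; false; false; false].
  by rewrite coef3L ?wf_expand //; compute_forms; ring.
have -> : coef3 (leval 7 (expand 7 3 c)) 1 2 7 =
    c [:: true; true; false; false; false; false; true].
  by rewrite coef3L ?wf_expand //; compute_forms; ring.
have -> : coef3 (leval 7 (expand 7 3 c)) 1 3 4 =
    c [:: true; false; true; true; false; false; false].
  by rewrite coef3L ?wf_expand //; compute_forms; ring.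
have -> : coef3 (leval 7 (expand 7 3 c)) 1 3 7 =
    c [:: true; false; true; false; false; false; true].
  by rewrite coef3L ?wf_expand //; compute_forms; ring.
have -> : coef3 (leval 7 (expand 7 3 c)) 1 2 6 =
    c [:: true; true; false; false; false; true; false].
  by rewrite coef3L ?wf_expand //; compute_forms; ring.
have -> : coef3 (leval 7 (expand 7 3 c)) 1 3 5 =
    c [:: true; false; true; false; true; false; false].
  by rewrite coef3L ?wf_expand //; compute_forms; ring.
split=> [psi0|[h1 h2 h3 [h4 h5 h6]]].
  (* Each relation is read off one coefficient of the 5-form: the bit sequence selects it, and [t]
     clears its sign and denominators. *)
  have vanish l (t x y : R) s : (forall s, size s = 7%N -> lcoef s l = 0) ->
      size s = 7%N -> x * v - y * v = t * lcoef s l -> x = y.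
    by move=> l0 ss; rewrite l0 // mulr0 => /subr0_eq /(mulIf v0).
  split; [..|split].
  - apply: (vanish _ (-1) _ _ [:: true; true; false; true; false; true; true] psi0) => //;
    compute_forms; by field; rewrite ?E0 ?G0.
  - apply: (vanish _ 1 _ _ [:: true; true; true; false; false; true; true] psi0) => //;
    compute_forms; by field; rewrite ?E0 ?G0.
  - apply: (vanish _ 1 _ _ [:: true; true; true; true; false; true; false] psi0) => //;
    compute_forms; by field; rewrite ?E0 ?G0.
  - apply: (vanish _ (-1) _ _ [:: true; true; true; false; true; false; true] psi0) => //;
    compute_forms; by field; rewrite ?E0 ?G0.
  - apply: (vanish _ (-1) _ _ [:: true; true; true; true; true; false; false] psi0) => //;
    compute_forms; by field; rewrite ?E0 ?G0.
  - apply: (vanish _ (- (E * G)) _ _ [:: true; true; true; true; false; false; true] psi0) => //;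
    compute_forms; by field; rewrite ?E0 ?G0.
have {}h6 : c [:: true; true; false; false; false; true; false] =
    G * c [:: true; false; true; false; true; false; false] / E.
  by rewrite -h6 mulrAC mulfV // mul1r.
(* Conversely, all 2^7 index sets are inspected: each coefficient is empty or vanishes by the six
   relations. *)
case=> [|a1 [|a2 [|a3 [|a4 [|a5 [|a6 [|a7 [|]]]]]]]] // _.
case: a1; case: a2; case: a3; case: a4; case: a5; case: a6; case: a7; compute_forms;
  rewrite ?h1 ?h2 ?h3 ?h4 ?h5 ?h6 //; by field; rewrite ?E0 ?G0.
Qed.

Lemma n52R2_metric_ix (E G : R) i j : (0 < i < 8)%N -> (0 < j < 8)%N ->
  n52R2_metric E G (ix i) (ix j) = nth 0 [:: 1; 1; 1; 1; E; G; 1] i.-1 *+ (i == j).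
Proof. by move=> hi hj; rewrite n52R2_metric_diag !mxE ixE // eq_ix. Qed.

Lemma mulf_eq0l (x y : R) : x != 0 -> x * y = 0 -> y = 0.
Proof. by move=> x0 /eqP; rewrite mulf_eq0 (negPf x0) => /eqP. Qed.

Lemma sum_2_8 (F : nat -> R) : \sum_(2 <= j < 8) F j =
  F 2%N + F 3%N + F 4%N + F 5%N + F 6%N + F 7%N.
Proof. by rewrite unlock /= addr0 !addrA. Qed.

(** * Sparse 2-forms on the span of f_2, ..., f_7 *)

Section Sparse.
Variable w : nat -> nat -> R.
Hypothesis w_anti : forall i j, (1 < i < 8)%N -> (1 < j < 8)%N -> w i j = - w j i.
Hypothesis w_sparse :
  [/\ w 2%N 3%N = 0, w 2%N 4%N = 0, w 2%N 7%N = 0, w 3%N 4%N = 0 & w 3%N 7%N = 0].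
(** With the five entries above equal to zero, this is minus the Pfaffian of [w]. *)
Hypothesis w_pf : w 4%N 7%N * (w 2%N 5%N * w 3%N 6%N - w 2%N 6%N * w 3%N 5%N) != 0.

Lemma sparse_rows (h : nat -> R) :
  [/\ \sum_(2 <= j < 8) w 2%N j * h j = w 2%N 5%N * h 5%N + w 2%N 6%N * h 6%N,
      \sum_(2 <= j < 8) w 3%N j * h j = w 3%N 5%N * h 5%N + w 3%N 6%N * h 6%N &
  [/\ \sum_(2 <= j < 8) w 4%N j * h j =
         w 4%N 5%N * h 5%N + w 4%N 6%N * h 6%N + w 4%N 7%N * h 7%N,
      \sum_(2 <= j < 8) w 5%N j * h j =
         - w 2%N 5%N * h 2%N - w 3%N 5%N * h 3%N - w 4%N 5%N * h 4%N
         + w 5%N 6%N * h 6%N + w 5%N 7%N * h 7%N,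
      \sum_(2 <= j < 8) w 6%N j * h j =
         - w 2%N 6%N * h 2%N - w 3%N 6%N * h 3%N - w 4%N 6%N * h 4%N
         - w 5%N 6%N * h 5%N + w 6%N 7%N * h 7%N &
      \sum_(2 <= j < 8) w 7%N j * h j =
         - w 4%N 7%N * h 4%N - w 5%N 7%N * h 5%N - w 6%N 7%N * h 6%N]].
Proof.
have D i : (1 < i < 8)%N -> w i i = 0 by move=> hi; have := w_anti hi hi; lra.
have [w23 w24 w27 w34 w37] := w_sparse; rewrite !sum_2_8.
rewrite (@w_anti 3%N 2%N) // (@w_anti 4%N 2%N) // (@w_anti 4%N 3%N) //.
rewrite (@w_anti 5%N 2%N) // (@w_anti 5%N 3%N) // (@w_anti 5%N 4%N) //.
rewrite (@w_anti 6%N 2%N) // (@w_anti 6%N 3%N) // (@w_anti 6%N 4%N) // (@w_anti 6%N 5%N) //.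
rewrite (@w_anti 7%N 2%N) // (@w_anti 7%N 3%N) // (@w_anti 7%N 4%N) // (@w_anti 7%N 5%N) //.
rewrite (@w_anti 7%N 6%N) // !D // w23 w24 w27 w34 w37.
split; [ring|ring|split; ring].
Qed.

Lemma sparse_solve2 (a b c d : R) :
  w 2%N 5%N * a + w 2%N 6%N * b = c -> w 3%N 5%N * a + w 3%N 6%N * b = d ->
  let D := w 2%N 5%N * w 3%N 6%N - w 2%N 6%N * w 3%N 5%N in
  D * a = w 3%N 6%N * c - w 2%N 6%N * d /\ D * b = w 2%N 5%N * d - w 3%N 5%N * c.
Proof. by move=> <- <- D; rewrite /D; split; ring. Qed.

(** Cramer's rule for the transposed block, which occurs in rows 5 and 6 by antisymmetry. *)
Lemma sparse_solve2_tr (a b c d : R) :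
  - w 2%N 5%N * a - w 3%N 5%N * b = c -> - w 2%N 6%N * a - w 3%N 6%N * b = d ->
  let D := w 2%N 5%N * w 3%N 6%N - w 2%N 6%N * w 3%N 5%N in
  D * a = w 3%N 5%N * d - w 3%N 6%N * c /\ D * b = w 2%N 6%N * c - w 2%N 5%N * d.
Proof. by move=> <- <- D; rewrite /D; split; ring. Qed.

(** Sparsity lets the system be eliminated in order: rows 2 and 3 give h_5 and h_6, row 4 gives h_7,
    row 7 gives h_4, and rows 5 and 6 then give h_2 and h_3. *)
Lemma sparse_nondegenerate (h : nat -> R) :
  (forall i, (1 < i < 8)%N -> \sum_(2 <= j < 8) w i j * h j = 0) ->
  forall j, (1 < j < 8)%N -> h j = 0.
Proof.
move=> wh; have [r2 r3 [r4 r5 r6 r7]] := sparse_rows h.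
rewrite !wh // in r2 r3 r4 r5 r6 r7.
have := w_pf; rewrite mulf_eq0 negb_or => /andP[w47 D0].
have [d5 d6] := sparse_solve2 (esym r2) (esym r3).
have h5 : h 5%N = 0 by apply: (mulf_eq0l D0); rewrite d5; ring.
have h6 : h 6%N = 0 by apply: (mulf_eq0l D0); rewrite d6; ring.
rewrite h5 h6 in r4 r5 r6 r7.
have h7 : h 7%N = 0 by apply: (mulf_eq0l w47); rewrite r4; ring.
have h4 : h 4%N = 0 by apply: (mulf_eq0l w47); apply/eqP; rewrite -oppr_eq0 r7; apply/eqP; ring.
rewrite h4 h7 in r5 r6.
have r5' : - w 2%N 5%N * h 2%N - w 3%N 5%N * h 3%N = 0 by rewrite r5; ring.
have r6' : - w 2%N 6%N * h 2%N - w 3%N 6%N * h 3%N = 0 by rewrite r6; ring.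
have [d2 d3] := sparse_solve2_tr r5' r6'.
have h2 : h 2%N = 0 by apply: (mulf_eq0l D0); rewrite d2; ring.
have h3 : h 3%N = 0 by apply: (mulf_eq0l D0); rewrite d3; ring.
by apply: cases_ix.
Qed.

(** For each fixed l the hypothesis is a linear system for row l of K, solved by the elimination of
    [sparse_nondegenerate]. Only rows 2, 3, 5 and 6 are needed. *)
Lemma sparse_inverse (K : nat -> nat -> R) (E G k : R) : 0 < E -> 0 < G -> k != 0 ->
  (forall i l : nat, (1 < i < 8)%N -> (1 < l < 8)%N -> \sum_(2 <= j < 8) w i j * K l j =
     k * (nth 0 [:: 1; 1; 1; 1; E; G; 1] i.-1 *+ (i == l))) ->
  \sum_(2 <= j < 8) K 5%N j * K j 5%N = \sum_(2 <= j < 8) K 6%N j * K j 6%N ->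
  E * w 2%N 6%N = G * w 3%N 5%N -> K 5%N 2%N + K 6%N 3%N = 0 -> G = E.
Proof.
move=> E0 G0 k0 wK tr cEG pure.
have := w_pf; rewrite mulf_eq0 negb_or => /andP[w47 D0].
set x := w 2%N 5%N in D0; set y := w 2%N 6%N in cEG D0; set z := w 3%N 5%N in cEG D0.
set t := w 3%N 6%N in D0; set D := x * t - y * z in D0.
have [r22 r23 _] := sparse_rows (K 2%N); rewrite !wK //= mulr1n mulr0n mulr1 mulr0 in r22 r23.
have [r32 r33 _] := sparse_rows (K 3%N); rewrite !wK //= mulr1n mulr0n mulr1 mulr0 in r32 r33.
have [K25 K26] := sparse_solve2 (esym r22) (esym r23).
have [K35 K36] := sparse_solve2 (esym r32) (esym r33).
(* For l = 5 or 6 the right sides of equations 2, 3, 4 and 7 vanish, so row l of K is supported on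
   columns 2 and 3. *)
have K56 (l : nat) : l = 5%N \/ l = 6%N -> [/\ K l 4%N = 0, K l 5%N = 0, K l 6%N = 0, K l 7%N = 0 &
    D * K l 2%N = k * (z * (G *+ (6%N == l)) - t * (E *+ (5%N == l))) /\
    D * K l 3%N = k * (y * (E *+ (5%N == l)) - x * (G *+ (6%N == l)))].
  move=> hl; have {}hl : [/\ (1 < l < 8)%N, 2%N == l = false, 3%N == l = false,
      4%N == l = false & 7%N == l = false] by case: hl => ->.
  have [l8 l2 l3 l4 l7] := hl; have [r2 r3 [r4 r5 r6 r7]] := sparse_rows (K l).
  rewrite !wK // ?l2 ?l3 ?l4 ?l7 /= ?mulr0n ?mulr0 in r2 r3 r4 r5 r6 r7.
  have [d5 d6] := sparse_solve2 (esym r2) (esym r3).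
  have h5 : K l 5%N = 0 by apply: (mulf_eq0l D0); rewrite d5; ring.
  have h6 : K l 6%N = 0 by apply: (mulf_eq0l D0); rewrite d6; ring.
  rewrite h5 h6 in r4 r5 r6 r7.
  have h7 : K l 7%N = 0 by apply: (mulf_eq0l w47); rewrite r4; ring.
  have h4 : K l 4%N = 0 by apply: (mulf_eq0l w47); apply/eqP; rewrite -oppr_eq0 r7; apply/eqP; ring.
  rewrite h4 h7 in r5 r6.
  have r5' : - w 2%N 5%N * K l 2%N - w 3%N 5%N * K l 3%N = k * (E *+ (5%N == l)) by rewrite r5; ring.
  have r6' : - w 2%N 6%N * K l 2%N - w 3%N 6%N * K l 3%N = k * (G *+ (6%N == l)) by rewrite r6; ring.
  have [d2 d3] := sparse_solve2_tr r5' r6'.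
  by split=> //; split; rewrite ?d2 ?d3 -/x -/y -/z -/t; ring.
have [K54 K55 K56' K57 [K52 K53]] := K56 5%N (or_introl erefl).
have [K64 K65 K66 K67 [K62 K63]] := K56 6%N (or_intror erefl).
rewrite !sum_2_8 K54 K55 K56' K57 K64 K65 K66 K67 in tr.
rewrite /= !(mulr0n, mulr1n) in K52 K53 K62 K63.
have {}pure : G * x + E * t = 0.
  apply: (mulf_eq0l k0); rewrite -[RHS]oppr0 -[in RHS](mulr0 D) -pure [in RHS]mulrDr K52 K63; ring.
(* Multiplied by - k^2, the two sides are D^2 times the diagonal entries 5 and 6 of K^2, where only
   the products through the indices 2 and 3 survive. *)
have {}tr : E * (t ^+ 2 + y ^+ 2) = G * (x ^+ 2 + z ^+ 2).
  apply: (mulfI (expf_neq0 2 k0)); apply: oppr_inj.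
  transitivity ((D * K 5%N 2%N) * (D * K 2%N 5%N) + (D * K 5%N 3%N) * (D * K 3%N 5%N)).
    by rewrite K52 K53 K25 K35 -/x -/y -/z -/t; ring.
  transitivity ((D * K 6%N 2%N) * (D * K 2%N 6%N) + (D * K 6%N 3%N) * (D * K 3%N 6%N)).
    by rewrite !(mulrACA D _ D) -!mulrDr; congr (_ * _); move: tr; rewrite !mul0r !addr0.
  by rewrite K62 K63 K26 K36 -/x -/y -/z -/t; ring.
have xz : x ^+ 2 + z ^+ 2 != 0.
  apply: contra_neq D0 => /eqP; rewrite paddr_eq0 ?sqr_ge0 // !sqrf_eq0 => /andP[/eqP x0 /eqP z0].
  by rewrite /D x0 z0 mul0r mulr0 subrr.
(* Replacing G (x^2 + z^2) by E (t^2 + y^2) in the term with E leaves (G x)^2 + (G z)^2 - (E t)^2 -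
   (E y)^2, which is zero because G x = - E t and G z = E y. *)
have : G * (x ^+ 2 + z ^+ 2) * (G - E) = 0.
  rewrite mulrBr -[X in _ - X * E]tr.
  transitivity ((G * x) ^+ 2 + (G * z) ^+ 2 - (E * t) ^+ 2 - (E * y) ^+ 2); last first.
    by rewrite cEG (_ : G * x = - (E * t)); [ring | apply/eqP; rewrite -addr_eq0 pure].
  by ring.
by move/eqP; rewrite !mulf_eq0 (negPf xz) (gt_eqF G0) subr_eq0 => /eqP.
Qed.
End Sparse.

(** * Necessity of G = E *)

Lemma metric_of_purely_coclosed (E G k : R) phi : 0 < E -> 0 < G -> k != 0 -> is_form 3 phi ->
  G2_mx phi = k *: n52R2_metric E G ->
  [/\ coef3 phi 1 2 3 = 0, coef3 phi 1 2 4 = 0, coef3 phi 1 2 7 = 0 &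
   [/\ coef3 phi 1 3 4 = 0, coef3 phi 1 3 7 = 0 & E * coef3 phi 1 2 6 = G * coef3 phi 1 3 5]] ->
  hitchin phi 5 2 + hitchin phi 6 3 = 0 -> G = E.
Proof.
move=> E0 G0 k0 f3 gE [c123 c124 c127 [c134 c137 cEG]] pure.
have g i j : (0 < i < 8)%N -> (0 < j < 8)%N ->
    G2_mx phi (ix i) (ix j) = k * (nth 0 [:: 1; 1; 1; 1; E; G; 1] i.-1 *+ (i == j)).
  by move=> hi hj; rewrite gE mxE n52R2_metric_ix.
have anti i j := @coef3_anti phi i j f3.
have sparse := And5 c123 c124 c127 c134 c137.
(* As f_1 has unit length, [k] is itself the Pfaffian of omega. *)
have pf : coef3 phi 1 4 7 *
    (coef3 phi 1 2 5 * coef3 phi 1 3 6 - coef3 phi 1 2 6 * coef3 phi 1 3 5) != 0.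
  apply: contra_neq k0 => pf0; have := G2_mx_11 f3.
  rewrite /= g //= mulr1n mulr1 c123 c124 c127 c134 c137 => ->.
  by apply: oppr_inj; rewrite oppr0 -[RHS]pf0; ring.
(* As f_1 is orthogonal to W, omega /\ rho pairs to zero with every row of the nondegenerate
   omega. *)
have h j : (1 < j < 8)%N -> hitchin phi 1 j = 0.
  apply: (sparse_nondegenerate anti sparse pf) => w hw.
  rewrite -(G2_mx_1 f3 hw) g //; last by case: w hw => [|[|w]].
  by case: w hw => [|[|w]] //= _; rewrite mulr0n !mulr0.
apply: (sparse_inverse anti sparse pf (k := 2 * k) E0 G0 _ _ (hitchin_square f3) cEG pure).
  by rewrite mulf_neq0 ?pnatr_eq0.
move=> i l hi hl; have := G2_mx_perp f3 hi hl; rewrite g; first last.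
- by case: (l) hl => [|[|?]].
- by case: (i) hi => [|[|?]].
rewrite mulrA => ->; rewrite [X in _ - X]big_nat [X in _ - X]big1 ?subr0 // => j hj.
by rewrite h ?mulr0.
Qed.

(** * A purely coclosed structure when G = E *)

(* With a = sqrt E, e^5 = a f^5 and e^6 = a f^6, this is
   e^125 - e^136 + e^147 + e^234 + e^456 + e^357 + e^267. *)
Definition std_form (a : R) : ext R 7 := leval 7
  [:: (a, [:: true; true; false; false; true; false; false]);
      (- a, [:: true; false; true; false; false; true; false]);
      (1, [:: true; false; false; true; false; false; true]);
      (1, [:: false; true; true; true; false; false; false]);
      (a ^+ 2, [:: false; false; false; true; true; true; false]);
      (a, [:: false; false; true; false; true; false; true]);
      (a, [:: false; true; false; false; false; true; true])].

Lemma std_form3 a : is_form 3 (std_form a).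
Proof. exact: leval_form. Qed.

Lemma ixP (i : 'I_7) : exists2 k, (0 < k < 8)%N & i = ix k.
Proof. by case: i => k hk; exists k.+1 => //; apply/val_inj; rewrite /= ixE. Qed.

(** The coframe e^1, ..., e^7, with e^i = f^i for i other than 5 and 6, is orthonormal for this
    metric; the factor a^2 comes from e^1234567 = a^2 f^1234567. *)
Lemma std_form_mx a : G2_mx (std_form a) = a ^+ 2 *: n52R2_metric (a ^+ 2) (a ^+ 2).
Proof.
apply/matrixP => i j; have [i' hi ->] := ixP i; have [j' hj ->] := ixP j.
rewrite G2_mxL // mxE n52R2_metric_ix //.
case: i' hi => [|[|[|[|[|[|[|[|?]]]]]]]] // _; case: j' hj => [|[|[|[|[|[|[|[|?]]]]]]]] // _;
  compute_forms; rewrite /= ?mulr0n ?mulr1n; by field.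
Qed.

Lemma n52R2_inner_product (E G : R) : 0 < E -> 0 < G -> inner_product (n52R2_metric E G).
Proof.
move=> E0 G0; rewrite n52R2_metric_diag; split=> [|v v0]; first exact: tr_diag_mx.
have d0 (i : 'I_7) : 0 < [:: 1; 1; 1; 1; E; G; 1]`_i.
  by case: i => -[|[|[|[|[|[|[|]]]]]]].
rewrite /bil mxE (eq_bigr (fun i : 'I_7 => [:: 1; 1; 1; 1; E; G; 1]`_i * v 0 i ^+ 2)) => [|i _].
  rewrite lt_def sumr_ge0 ?andbT => [|i _]; last by rewrite mulr_ge0 ?sqr_ge0 ?ltW.
  rewrite psumr_neq0 => [|i _]; last by rewrite mulr_ge0 ?sqr_ge0 ?ltW.
  have /rV0Pn[i vi] := v0; apply/hasP; exists i; first exact: mem_index_enum.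
  by rewrite mulr_gt0 // lt_def sqrf_eq0 vi sqr_ge0.
by rewrite mul_mx_diag !mxE; ring.
Qed.

Lemma std_form_induces a : 0 < a ->
  G2_induces (std_form a) (n52R2_metric (a ^+ 2) (a ^+ 2)) (a ^+ 2 *: monomial R setT).
Proof.
move=> a0; split; first by apply: n52R2_inner_product; rewrite exprn_gt0.
  split=> [A nA|]; rewrite ext_scaleE ffunE.
    case: eqP => [AE|_]; last by rewrite mulr0.
    by rewrite AE cardsT card_ord eqxx in nA.
  rewrite eqxx mulr1 n52R2_metric_diag det_diag.
  by rewrite !big_ord_recl big_ord0 !mxE /=; ring.
move=> v w; rewrite -/(G2_form _ v w) [RHS](top_formE (G2_form_top v w (std_form3 a))).
by rewrite -G2_mxE std_form_mx bilZ scalerA mulrC.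
Qed.

Lemma std_form_G2 a : 0 < a -> G2_structure (std_form a).
Proof.
move=> a0; split=> [|v v0]; first exact: std_form3.
have [[_ pos] [_ vol2] gE] := std_form_induces a0; apply/eqP => wedge0.
have /ffunP/(_ setT) := gE v v; rewrite wedge0 scaler0 !ext_scaleE !ffunE eqxx mulr1 => /eqP.
by rewrite mulf_eq0 sqrf_eq0 (gt_eqF a0) orbF gt_eqF ?pos.
Qed.

(** Here omega = e^25 - e^36 + e^47, so all entries in [coclosedP] vanish. The opposite signs of
    e^25 and e^36 make K_52 and K_63 cancel. *)
Lemma std_form_purely_coclosed a : 0 < a -> purely_coclosed (@n52R2_bracket R) (std_form a).
Proof.
(* Uniqueness of the induced pair identifies the chosen metric and volume form with the explicit
   ones. *)
move=> a0; have [gE vE] := G2_induces_inj (G2_inducesP (std_form_G2 a0)) (std_form_induces a0).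
have a2 : a ^+ 2 != 0 by rewrite sqrf_eq0 gt_eqF.
split.
  rewrite /G2_hodge gE vE; apply/(coclosedP a2 a2 _ (std_form3 a)).
    by rewrite ext_scaleE ffunE eqxx mulr1.
  by rewrite !coef3L.
have f7 : is_form 7 (wedge (CE_diff (@n52R2_bracket R) (std_form a)) (std_form a)).
  apply: (@wedge_form _ _ 4 3) (std_form3 a) => A nA; rewrite ext_sumE big1 // => i _.
  apply: (@wedge_form _ _ 2 2) => //; first exact: d_covec_form.
  exact/interior_form/std_form3.
rewrite (top_formE f7) CE_diff_wedge_self; last exact: std_form3.
rewrite !hitchinL //; compute_forms; rewrite (_ : - _ = 0) ?scale0r //; ring.
Qed.
End Seven.

Theorem proposition5p8 (R : realType) (E G : R) (hE : 0 < E) (hEG : E <= G) :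
  (exists phi : ext R 7,
     [/\ G2_structure phi,
         purely_coclosed (@n52R2_bracket R) phi
       & G2_metric phi = n52R2_metric E G])
  <-> G = E.
Proof.
split=> [[phi [phiG2 [coclosed pure] gE]]|->].
  have [f3 _] := phiG2; have ind := G2_inducesP phiG2.
  (* The square of the volume coefficient is det g > 0, so this coefficient is nonzero and serves as
     the scale [k]. *)
  have [[_ pos] [_ vol2] _] := ind; have := det_gt0 pos; rewrite -vol2 exprn_even_gt0 //= => k0.
  have hG := lt_le_trans hE hEG; have mxE := G2_induces_scale ind; rewrite gE in mxE.
  apply: (metric_of_purely_coclosed hE hG k0 f3 mxE).
    apply/(coclosedP (lt0r_neq0 hE) (lt0r_neq0 hG) k0 f3).
    by rewrite -gE.
  apply: oppr_inj; rewrite oppr0 -CE_diff_wedge_self // pure.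
  by rewrite ffunE.
(* f_5 and f_6 have squared length E, so rescaling f^5 and f^6 by sqrt E gives unit covectors. *)
have a0 : 0 < Num.sqrt E by rewrite sqrtr_gt0.
have EE : Num.sqrt E ^+ 2 = E by rewrite sqr_sqrtr ?ltW.
exists (std_form (Num.sqrt E)); split; [exact: std_form_G2|exact: std_form_purely_coclosed|].
by have [-> _] := G2_induces_inj (G2_inducesP (std_form_G2 a0)) (std_form_induces a0); rewrite EE.
Qed.
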